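(* Let $k$ be an algebraically closed field of arbitrary characteristic, let $n\ge 1$, and let $V\subset \mathbb{A}^n$ be an affine subvariety defined over $\overline{k(t)}$. Let $W\subseteq V$ be the Zariski closure of $V(k)$. Then there exists a real number $\epsilon>0$ such that for all $P\in (V\setminus W)(\overline{k(t)})$ we have $h(P)\ge \epsilon$.
   Context: Here $t$ is an indeterminate and $\overline{k(t)}$ is a fixed algebraic closure of $k(t)$. Subvarieties of $\mathbb{A}^n$ are Zariski closed and not assumed irreducible. $V(k)$ denotes the set of points of $V$ all of whose coordinates lie in $k$. Height: the places $\Omega_{k(t)}$ of $k(t)$ are $v_\infty(f/g)=\deg g-\deg f$ and, for each $\alpha\in k$, $v_\alpha(f/g)=\mathrm{ord}_{t-\alpha}(f/g)$, for nonzero $f,g\in k[t]$. For a finite extension $K$ of $k(t)$, $\Omega_K$ is the set of all (inequivalent) places of $K$ lying above places of $k(t)$, each exponential valuation $w\in\Omega_K$ being normalized to have value group exactly $\mathbb{Z}$ on $K^*$ (so $w(x)=e(w\mid v)v(x)$ for $x\in k(t)^*$ and $w\mid v$, where $e(w\mid v)$ is the ramification index), with $w(0)=+\infty$. For $(x_1,\dots,x_n)\in\mathbb{A}^n(\overline{k(t)})$ with all $x_i$ in the finite extension $K$ of $k(t)$, $$h((x_1,\dots,x_n)):=\frac{1}{[K:k(t)]}\sum_{v\in\Omega_{k(t)}}\ \sum_{w\in\Omega_K,\ w\mid v}\max\{0,-w(x_1),\dots,-w(x_n)\}.$$ This does not depend on the choice of $K$. *)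

(* Defs.v *)
From HB Require Import structures.
From mathcomp Require Import all_boot all_order all_algebra all_field.
From mathcomp Require Import generic_quotient.
From mathcomp Require Import all_classical all_reals.
(* not imported: the notations of mpoly clash with those of mathcomp-classical *)
From mathcomp Require mpoly.

Set Implicit Arguments.
Unset Strict Implicit.
Unset Printing Implicit Defensive.

Import Order.TTheory GRing.Theory Num.Theory.

Local Open Scope classical_set_scope.
Local Open Scope ring_scope.

Notation ratfun k := {fraction {poly k}}.

Definition is_algebraic_closure (F : fieldType) (L : closedFieldType)
    (iota : {rmorphism F -> L}) : Prop :=
  forall x : L, algebraicOver iota x.

Section Places.
Variable k : closedFieldType.

(* The places of k(t): [Some a] is v_a and [None] is v_infty. *)
Definition place : Type := option k.

(* The value does not depend on the representative f/g chosen by [repr].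
   [mup a f] is the multiplicity of a as a root of f, i.e. ord_(t - a) f,
   and [(size f).-1] is the degree of f when f != 0. *)
Definition place_val (v : place) (x : ratfun k) : \bar int :=
  let f := \n_(repr x) in
  let g := \d_(repr x) in
  if x == 0 then +oo%E else
  match v with
  | None => ((size g).-1%:Z - (size f).-1%:Z)%:E
  | Some a => ((mup a f)%:Z - (mup a g)%:Z)%:E
  end.

(* Exponential valuations with value group exactly Z; two distinct ones are
   inequivalent, so these functions represent each place exactly once. *)
Definition normalized_valuation (K : fieldType) (w : K -> \bar int) : Prop :=
  [/\ forall x, (w x == +oo%E) = (x == 0),
      forall x, w x != -oo%E,
      forall x y, w (x * y) = (w x + w y)%E,
      forall x y, (Order.min (w x) (w y) <= w (x + y)%R)%E
    & forall m : int, exists x, w x = m%:E].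

(* w | v; the integer e is the ramification index e(w | v). *)
Definition lies_above (K : fieldExtType (ratfun k))
    (w : K -> \bar int) (v : place) : Prop :=
  exists2 e : nat, (0 < e)%N &
    forall x : ratfun k, x != 0 -> w x%:A = (e%:Z%:E * place_val v x)%E.

Definition places_above (K : fieldExtType (ratfun k)) (v : place) :
    set (K -> \bar int) :=
  [set w | normalized_valuation w /\ lies_above w v].

(* max {0, - w x_1, ..., - w x_n}; this is never infinite, as w > -oo. *)
Definition local_height (K : fieldType) (n : nat) (w : K -> \bar int)
    (x : 'I_n -> K) : int :=
  fine (\big[Order.max/0%E]_(i < n) (- w (x i))%E).

(* Both sums have finite support. *)
Definition height_in (R : realType) (K : fieldExtType (ratfun k)) (n : nat)
    (x : 'I_n -> K) : R :=
  (\dim {:K})%:R^-1 *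
  \sum_(v \in [set: place]) \sum_(w \in @places_above K v)
     ((local_height w x)%:~R : R).

Variables (L : closedFieldType) (iota : {rmorphism ratfun k -> L}).

(* The value of [height_in] in any finite extension K of k(t) inside L that
   contains the coordinates of P; it does not depend on K, and the default
   value 0 is not used when L is algebraic over k(t). *)
Definition height (R : realType) (n : nat) (P : 'I_n -> L) : R :=
  xget 0 [set r | exists (K : fieldExtType (ratfun k)) (j : {rmorphism K -> L})
                         (x : 'I_n -> K),
            [/\ forall a : ratfun k, j a%:A = iota a,
                forall i, j (x i) = P i
              & r = height_in R x]].

Definition constant_points (n : nat) : set ('I_n -> L) :=
  [set P | forall i, exists c : k, P i = iota (FracField.tofrac c%:P)].

End Places.

Section Zariski.
Variables (L : fieldType) (n : nat).

Definition zariski_closed (V : set ('I_n -> L)) : Prop :=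
  exists S : set (mpoly.mpoly n L),
    V = [set P | forall p, S p -> mpoly.meval P p = 0].

Definition zariski_closure (A : set ('I_n -> L)) : set ('I_n -> L) :=
  \bigcap_(Z in [set Z | zariski_closed Z /\ A `<=` Z]) Z.

End Zariski.

(* Main.v *)
Require Import Defs.
From HB Require Import structures.
From mathcomp Require Import all_boot all_order all_algebra all_field.
From mathcomp Require Import all_classical all_reals.
From mathcomp Require Import ring zify.
From mathcomp Require mpoly.
Import (canonicals, coercions) mpoly.

Set Implicit Arguments.
Unset Strict Implicit.
Unset Printing Implicit Defensive.

Import Order.TTheory GRing.Theory Num.Theory.

Local Open Scope classical_set_scope.
Local Open Scope ring_scope.

(** The proof has an algebraic part, which turns the equations of V into
    equations over k, and a geometric part, a lower bound for heights that comes
    from Riemann's inequality.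

    The algebraic part. Finitely many polynomials f cut out V
    ([finite_equations]). Each of them is replaced by its norm G down to k(t),
    written as G = sum_i t^i G_i with G_i in k[X]: if f vanishes at P then
    sum_i t^i G_i(P) = 0, while at a constant point c, where the G_i(c) lie in k,
    the vanishing of all of them means f(c) = 0 ([norm_polynomial]). So the
    constant points of V are the common zeros in k^n of the finitely many G_i.
    If P lies in V but not in the closure W of these points, then some G_i(P) is
    nonzero: a polynomial that separates P from W may be taken with coefficients
    in k ([descend_to_constants]), and if all G_i vanished at P, reduction modulo
    a place of k(t, P) with no pole at the relevant elements would give a
    constant point of V at which this polynomial does not vanish
    ([specialization]).

    The geometric part. Let K be an extension of degree d of k(t) that contains
    the coordinates of P, and let y_i = G_i(P), so that sum_i t^i y_i = 0 with
    the y_i not all zero. For c in k outside a finite set, z = sum_i c^i y_i is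
    nonzero, and by the relation z and q = z / (t - c) both have their poles
    bounded by the pole divisor Y of the y_i. Thus t - c = z / q is a quotient of
    two elements of L(Y), and comparing the dimension of L(N Y) with the number
    of products z^i q^(N-i) for large N gives d <= deg Y ([degree_le_poles]).
    As deg Y is at most D d h(P), where D bounds the degrees of the G_i, this
    yields h(P) >= 1/D, with D depending only on V.

    Riemann's inequality dim L(D) <= deg D + 1 ([riemann]) rests on three facts
    about the valuations of K: their residue field is k ([residue_exists]), an
    element outside k has a pole ([exists_pole], from a maximal subring that
    avoids it), and every element has only finitely many poles ([finite_poles],
    by weak approximation). *)

(** * Discrete valuations *)

Section Valuation.
Variables (K : fieldType) (w : K -> \bar int) (hw : normalized_valuation w).

Let w_eqoo x : (w x == +oo%E) = (x == 0). Proof. by case: hw. Qed.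
Let w_neqNoo x : w x != -oo%E. Proof. by case: hw. Qed.

Lemma nvalM x y : w (x * y) = (w x + w y)%E. Proof. by case: hw. Qed.

Lemma nval0 : w 0 = +oo%E. Proof. by apply/eqP; rewrite w_eqoo. Qed.

Lemma nval_fin x : x != 0 -> exists m : int, w x = m%:E.
Proof.
rewrite -w_eqoo; case E : (w x) => [m| |] //=; first by exists m.
by move: (w_neqNoo x); rewrite E.
Qed.

Lemma nval1 : w 1 = 0%E.
Proof.
have [m wm] := nval_fin (oner_neq0 K).
have := nvalM 1 1; rewrite mulr1 wm -EFinD => -[] /eqP.
by rewrite -subr_eq0 opprD addNKr oppr_eq0 => /eqP->.
Qed.

Lemma nvalX x m n : w x = m%:E -> w (x ^+ n) = (m *+ n)%:E.
Proof.
move=> wx; elim: n => [|n IH]; first by rewrite expr0 nval1.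
by rewrite exprS nvalM IH wx -EFinD mulrS.
Qed.

Lemma nvalV x m : w x = m%:E -> w x^-1 = (- m)%:E.
Proof.
move=> wx; have x0 : x != 0 by rewrite -w_eqoo wx.
have [l wl] := nval_fin (invr_neq0 x0).
have := nvalM x x^-1; rewrite mulfV// nval1 wx wl -EFinD => -[] /eqP.
by rewrite eq_sym addrC addr_eq0 => /eqP->.
Qed.

Lemma nvalXz x (m l : int) : w x = m%:E -> w (x ^ l) = (m *~ l)%:E.
Proof.
case: l => n wx; first exact: nvalX.
by rewrite NegzE -exprz_inv (nvalX n.+1 (nvalV wx)) mulrNz mulNrn.
Qed.

Lemma nvalN x : w (- x) = w x.
Proof.
have [m wm] : exists m : int, w (-1) = m%:E by apply: nval_fin; rewrite oppr_eq0 oner_eq0.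
have := nvalM (-1) (-1); rewrite mulrNN mulr1 nval1 wm -EFinD => -[] /esym/eqP.
rewrite -mulr2n mulrn_eq0 /= => /eqP m0.
by rewrite -mulN1r nvalM wm m0 add0e.
Qed.

Lemma nval_addl (m : \bar int) x y : (m <= w x)%E -> (m <= w y)%E -> (m <= w (x + y)%R)%E.
Proof.
move=> mx my; case: hw => _ _ _ /(_ x y) + _; apply: le_trans.
by rewrite le_min mx my.
Qed.

Lemma nval_addlt (m : \bar int) x y : (m < w x)%E -> (m < w y)%E -> (m < w (x + y)%R)%E.
Proof.
move=> mx my; case: hw => _ _ _ /(_ x y) + _; apply: lt_le_trans.
by rewrite lt_min mx my.
Qed.

Lemma nval_sum (m : int) (I : finType) (P : pred I) (F : I -> K) :
  (forall i, P i -> (m%:E <= w (F i))%E) -> (m%:E <= w (\sum_(i | P i) F i)%R)%E.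
Proof.
move=> h; apply: (@big_ind _ (fun x => (m%:E <= w x)%E)) => //.
- by rewrite nval0 leey.
- by move=> x y; exact: nval_addl.
Qed.

Lemma nval_sumlt (m : int) (I : finType) (P : pred I) (F : I -> K) :
  (forall i, P i -> (m%:E < w (F i))%E) -> (m%:E < w (\sum_(i | P i) F i)%R)%E.
Proof.
move=> h; apply: (@big_ind _ (fun x => (m%:E < w x)%E)) => //.
- by rewrite nval0 ltey.
- by move=> x y; exact: nval_addlt.
Qed.

Lemma nval_geM (m l : int) x y :
  (m%:E <= w x)%E -> (l%:E <= w y)%E -> ((m + l)%:E <= w (x * y)%R)%E.
Proof. by move=> mx ly; rewrite nvalM EFinD leeD. Qed.

Lemma nval_mulgt0l x y : (0 < w x)%E -> (0 <= w y)%E -> (0 < w (x * y)%R)%E.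
Proof.
move=> x0 y0; rewrite nvalM; case: (w x) x0 (w y) y0 => [a| |] //= a0 [b| |] //=.
by rewrite -EFinD !lte_fin !lee_fin in a0 * => b0; rewrite ltr_wpDr.
Qed.

Lemma nval_geX0 x n : (0 <= w x)%E -> (0 <= w (x ^+ n))%E.
Proof.
move=> x0; elim: n => [|n IH]; first by rewrite expr0 nval1.
by rewrite exprS nvalM adde_ge0.
Qed.

Lemma nval_dom x y : (w x < w y)%E -> w (x + y) = w x.
Proof.
move=> xy; apply/eqP; rewrite eq_le; apply/andP; split; last first.
  by apply: nval_addl => //; apply: ltW.
rewrite leNgt; apply/negP => lt.
have : (w x < w (x + y + - y)%R)%E by apply: nval_addlt => //; rewrite nvalN.
by rewrite addrK ltxx.
Qed.

Lemma nval_prod_gt0 (s : seq K) : (0 < w (\prod_(x <- s) x))%E ->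
  exists2 x, x \in s & (0 < w x)%E.
Proof.
elim: s => [|x s IH]; first by rewrite big_nil nval1 ltxx.
rewrite big_cons nvalM => h; have [xp|xn] := boolP (0 < w x)%E.
  by exists x => //; rewrite mem_head.
have /IH[y ys yp] : (0 < w (\prod_(j <- s) j))%E.
  rewrite ltNge; apply: contraL h => h'; rewrite -leNgt.
  by rewrite -[leRHS]adde0 leeD// leNgt.
by exists y => //; rewrite inE ys orbT.
Qed.

End Valuation.

(** * Residues in an algebraically closed field of constants *)

Section Constants.
Variables (k : closedFieldType) (K : fieldType) (kap : {rmorphism k -> K}).
Variables (w : K -> \bar int) (hw : normalized_valuation w).

(** k^* is divisible, so the integer w c is divisible by every positive
    integer. *)
Lemma nval_const c : c != 0 -> w (kap c) = 0%E.
Proof.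
move=> c0; have [m wm] : exists m : int, w (kap c) = m%:E.
  by apply: (nval_fin hw); rewrite fmorph_eq0.
have [b bE] : exists b, b ^+ `|m|.+1 = c.
  have : size ('X^(`|m|.+1) - c%:P : {poly k}) != 1%N by rewrite size_XnsubC.
  move=> /closed_rootP[b]; rewrite rootE !hornerE subr_eq0 => /eqP.
  by exists b.
have b0 : kap b != 0.
  by rewrite fmorph_eq0; apply: contraNneq c0 => b0; rewrite -bE b0 expr0n.
have [l wl] := nval_fin hw b0.
have := nvalX hw `|m|.+1 wl; rewrite -rmorphXn bE wm => -[mE].
have [l0|l0] := eqVneq l 0; first by rewrite mE l0 mul0rn.
have := congr1 absz mE; rewrite -mulr_natr natz abszM absz_nat => E.
have : (0 < `|l|)%N by rewrite absz_gt0.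
by case: `|l|%N E => // a E _; move: (leqnn `|m|%N); rewrite {1}E mulSn addSn ltnNge leq_addr.
Qed.

Lemma nval_const_ge0 c : (0 <= w (kap c))%E.
Proof.
by have [->|/nval_const->//] := eqVneq c 0; rewrite rmorph0 (nval0 hw) leey.
Qed.

(** c is the image of x in the residue field of w. *)
Definition residue x c := (0 < w (x - kap c))%E.

Lemma residue_const c : residue (kap c) c.
Proof. by rewrite /residue subrr (nval0 hw) ltey. Qed.

Lemma residue_ge0 x c : residue x c -> (0 <= w x)%E.
Proof.
move=> h; rewrite -(subrK (kap c) x); apply: (nval_addl hw).
  exact: ltW.
exact: nval_const_ge0.
Qed.

Lemma residueD x y a b : residue x a -> residue y b -> residue (x + y) (a + b).
Proof.
move=> hx hy; rewrite /residue rmorphD opprD addrACA.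
exact: (nval_addlt hw).
Qed.

Lemma residueM x y a b : residue x a -> residue y b -> residue (x * y) (a * b).
Proof.
move=> hx hy; rewrite /residue rmorphM.
have -> : x * y - kap a * kap b = (x - kap a) * y + (y - kap b) * kap a.
  by rewrite !mulrBl (mulrC (kap b)) (mulrC y) addrA subrK.
apply: (nval_addlt hw); apply: (nval_mulgt0l hw) => //.
- exact: residue_ge0 hy.
- exact: nval_const_ge0.
Qed.

Lemma residue_uniq x a b : residue x a -> residue x b -> a = b.
Proof.
move=> ha hb; apply: contraTeq ha => ab; rewrite -leNgt.
have := nval_const; rewrite -subr_eq0 in ab => /(_ _ ab) E.
rewrite leNgt; apply/negP => ha.
suff : (0 < w (kap (a - b)%R))%E by rewrite E ltxx.
have -> : kap (a - b) = (x - kap b) + - (x - kap a).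
  by rewrite opprB addrCA addrAC subrr add0r rmorphB.
by apply: (nval_addlt hw); rewrite ?(nvalN hw).
Qed.

Lemma residue0 x : residue x 0 = (0 < w x)%E.
Proof. by rewrite /residue rmorph0 subr0. Qed.

Lemma residue_neq0 x c : residue x c -> c != 0 -> w x = 0%E.
Proof.
move=> h c0; apply/eqP; rewrite eq_le (residue_ge0 h) andbT leNgt -residue0.
by apply/negP => /(residue_uniq h) /eqP; apply/negP.
Qed.

Lemma residue_sum (I : finType) (F : I -> K) (c : I -> k) :
  (forall i, residue (F i) (c i)) -> residue (\sum_i F i) (\sum_i c i).
Proof.
move=> h; apply: (big_rec2 (fun x c => residue x c)).
  by rewrite -(rmorph0 kap) residue_const.
by move=> i x y _; apply: residueD.
Qed.

Lemma residueX x a n : residue x a -> residue (x ^+ n) (a ^+ n).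
Proof.
move=> h; elim: n => [|n IH]; last by rewrite !exprS residueM.
by rewrite !expr0 -(rmorph1 kap) residue_const.
Qed.

Lemma residue_prod (I : finType) (F : I -> K) (c : I -> k) :
  (forall i, residue (F i) (c i)) -> residue (\prod_i F i) (\prod_i c i).
Proof.
move=> h; apply: (big_rec2 (fun x c => residue x c)).
  by rewrite -(rmorph1 kap) residue_const.
by move=> i x y _; apply: residueM.
Qed.

Lemma residueV x a : residue x a -> a != 0 -> residue x^-1 a^-1.
Proof.
move=> h a0; have wx := residue_neq0 h a0.
have x0 : x != 0.
  by apply/negP => /eqP x0; move: wx; rewrite x0 (nval0 hw).
have -> : x^-1 = (x * kap a^-1 + (1 - x * kap a^-1)) * x^-1.
  by rewrite addrCA subrr addr0 mul1r.
rewrite mulrDl mulrAC mulfV// mul1r -[X in residue _ X]addr0.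
apply: residueD; first exact: residue_const.
rewrite residue0; apply: (nval_mulgt0l hw); last by rewrite (nvalV hw wx) oppr0.
rewrite -(nvalN hw) opprB -residue0.
have := residueD (residueM h (residue_const a^-1)) (residue_const (-1)).
by rewrite mulfV// subrr rmorphN1.
Qed.

(** Over the algebraically closed k the polynomial p splits, and one of its
    linear factors must be small at x. *)
Lemma nval_poly_gt0 (p : {poly k}) x : p != 0 -> (0 < w (map_poly kap p).[x])%E ->
  exists2 c, root p c & residue x c.
Proof.
move=> p0; have [rs pE] := closed_field_poly_normal p.
rewrite pE map_polyZ hornerZ (nvalM hw) nval_const ?lead_coef_eq0// add0e.
rewrite rmorph_prod horner_prod.
rewrite (eq_bigr (fun z => x - kap z)); last first.
  by move=> z _; rewrite rmorphB /= map_polyX map_polyC !hornerE.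
rewrite -(big_map _ xpredT id) => /(nval_prod_gt0 hw)[_ /mapP[c crs ->] h].
exists c => //; rewrite rootE hornerZ horner_prod (big_rem c)//=.
by rewrite !hornerE subrr /= mulr0 mul0r.
Qed.

End Constants.

(** * Valuations of a function field *)

Section FunctionField.
Variables (k : closedFieldType) (K : fieldType) (kap : {rmorphism k -> K}) (t : K).

Definition at_t : {poly k} -> K := horner_eval t \o map_poly kap.

HB.instance Definition _ := GRing.RMorphism.copy at_t (horner_eval t \o map_poly kap).

Lemma at_tE p : at_t p = (map_poly kap p).[t]. Proof. by []. Qed.

Lemma at_t_sum p : at_t p = \sum_(i < size p) kap p`_i * t ^+ i.
Proof.
rewrite at_tE horner_coef size_map_poly; apply: eq_bigr => i _.
by rewrite coef_map.
Qed.

Lemma at_tC c : at_t c%:P = kap c.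
Proof. by rewrite at_tE map_polyC hornerC. Qed.

Lemma at_tX : at_t 'X = t.
Proof. by rewrite at_tE map_polyX hornerX. Qed.

Lemma at_tXsubC c : at_t ('X - c%:P) = t - kap c.
Proof. by rewrite rmorphB /= at_tX at_tC. Qed.

(** Together with the existence of a family as in [free_over] this says that
    K has degree d over k(t). Denominators are cleared, so that k(t) itself
    does not occur. *)
Definition dependent_over (d : nat) := forall z : 'I_d.+1 -> K,
  exists p : 'I_d.+1 -> {poly k},
    (exists i, p i != 0) /\ \sum_i at_t (p i) * z i = 0.

Definition free_over (d : nat) (b : 'I_d -> K) := forall p : 'I_d -> {poly k},
  \sum_i at_t (p i) * b i = 0 -> forall i, p i = 0.


Hypothesis t_trans : injective at_t.

Lemma at_t_eq0 p : (at_t p == 0) = (p == 0).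
Proof. by rewrite -(inj_eq t_trans) rmorph0. Qed.

Lemma t_neq_const c : t - kap c != 0.
Proof. by rewrite -at_tXsubC at_t_eq0 polyXsubC_eq0. Qed.

Lemma t_neq0 : t != 0.
Proof. by rewrite -at_tX at_t_eq0 polyX_eq0. Qed.

Section At_valuation.
Variables (w : K -> \bar int) (hw : normalized_valuation w).

Local Notation residue := (residue kap w).

Lemma residue_at_t p a : residue t a -> residue (at_t p) p.[a].
Proof.
move=> ta; rewrite at_t_sum horner_coef; apply: (residue_sum hw) => i.
by apply: (residueM hw); [exact: residue_const|exact: residueX].
Qed.

(** Once the power of t - a is divided out, p takes a nonzero value at a. *)
Lemma local_form_finite a p : residue t a -> p != 0 ->
  exists2 c, c != 0 & residue (at_t p / (t - kap a) ^+ mup a p) c.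
Proof.
move=> ta p0; have [m [q]] := multiplicity_XsubC p a.
rewrite p0 /= => qa pE; have mE : mup a p = m.
  by rewrite pE mupMr// mup_XsubCX eqxx.
rewrite mE pE rmorphM rmorphXn /= at_tXsubC; exists q.[a].
  by rewrite -rootE.
by rewrite mulfK ?expf_neq0 ?t_neq_const//; exact: residue_at_t.
Qed.

Lemma nval_finite_pole_ge0 p : (0 <= w t)%E -> (0 <= w (at_t p))%E.
Proof.
move=> t0; rewrite at_t_sum; apply: (nval_sum hw) => i _.
rewrite -[0%:E]/((0 + 0)%:E); apply: (nval_geM hw); first exact: nval_const_ge0.
exact: nval_geX0.
Qed.

(** At t = infinity the top term of p dominates all the others. *)
Lemma local_form_infty p : (w t < 0)%E -> p != 0 ->
  residue (at_t p / t ^+ (size p).-1) (lead_coef p).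
Proof.
move=> t0 p0; have [m wt] := nval_fin hw t_neq0.
have Vt0 : (0 < w t^-1)%E.
  by rewrite (nvalV hw wt) lte_fin oppr_gt0 -lte_fin -wt.
have lE : lead_coef p = \sum_(i < size p) (if i == (size p).-1 :> nat then lead_coef p else 0).
  have sp : ((size p).-1 < size p)%N by rewrite prednK ?size_poly_gt0.
  rewrite (bigD1 (Ordinal sp)) //= eqxx big1 ?addr0 // => i.
  by rewrite -val_eqE /= => /negPf->.
rewrite at_t_sum mulr_suml [X in residue _ X]lE; apply: (residue_sum hw) => i.
have [iE|ine] := eqVneq (i : nat) (size p).-1.
  by rewrite iE mulfK ?expf_neq0 ?t_neq0//; exact: residue_const.
have ilt : (i < (size p).-1)%N.
  by rewrite ltn_neqAle ine -ltnS prednK ?ltn_ord// size_poly_gt0.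
rewrite (residue0 kap) -mulrA mulrC; apply: (nval_mulgt0l hw).
  have -> : t ^+ i / t ^+ (size p).-1 = t^-1 * t^-1 ^+ ((size p).-1 - i).-1.
    rewrite -exprS prednK ?subn_gt0// exprVn.
    have -> : t ^+ (size p).-1 = t ^+ i * t ^+ ((size p).-1 - i).
      by rewrite -exprD subnKC// ltnW.
    by rewrite invfM mulrA mulfV ?mul1r// expf_neq0// t_neq0.
  by apply: (nval_mulgt0l hw) => //; apply: (nval_geX0 hw); exact: ltW.
exact: nval_const_ge0.
Qed.

Lemma nval_finite a p : residue t a -> p != 0 ->
  w (at_t p) = w ((t - kap a) ^+ mup a p).
Proof.
move=> ta p0; have [c c0 /residue_neq0 h] := local_form_finite ta p0.
by rewrite -[at_t p](divfK (expf_neq0 (mup a p) (t_neq_const a))) (nvalM hw) h// add0e.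
Qed.

Lemma nval_infty p : (w t < 0)%E -> p != 0 ->
  w (at_t p) = w (t ^+ (size p).-1).
Proof.
move=> t0 p0; have := residue_neq0 hw (local_form_infty t0 p0).
rewrite lead_coef_eq0 => /(_ p0) h.
by rewrite -[at_t p](divfK (expf_neq0 (size p).-1 t_neq0)) (nvalM hw) h// add0e.
Qed.

Variables (d : nat) (K_dep : dependent_over d).

(** Otherwise w would vanish on the nonzero polynomials in t, and a relation
    over k[t] between the powers of an element of value -1 would have a single
    dominant term. *)
Lemma center_finite : (0 <= w t)%E -> exists a, residue t a.
Proof.
move=> t0; suff [f f0 fgt0] : exists2 f, f != 0 & (0 < w (at_t f))%E.
  by have [a _ ra] := nval_poly_gt0 hw f0 fgt0; exists a.
apply: contrapT => noroot.
have unit_t f : f != 0 -> w (at_t f) = 0%E.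
  move=> f0; apply/eqP; rewrite eq_le nval_finite_pole_ge0// andbT leNgt.
  by apply/negP => fp; apply: noroot; exists f.
have [x wx] : exists x, w x = (-1)%:E by case: hw.
have [p [[i1 pi1]]] := K_dep (fun i => x ^+ i).
have [i pi imax] := @arg_maxnP _ i1 (fun i => p i != 0) (fun i : 'I_d.+1 => i : nat) pi1.
rewrite (bigD1 i)//= => /eqP; rewrite addr_eq0 => /eqP E.
have : (w (at_t (p i) * x ^+ i) < w (- (\sum_(j < d.+1 | j != i) at_t (p j) * x ^+ j))%R)%E.
  rewrite (nvalN hw) (nvalM hw) unit_t// add0e (nvalX hw _ wx).
  apply: (nval_sumlt hw) => j ji.
  have [pj0|pj0] := eqVneq (p j) 0.
    by rewrite pj0 rmorph0 mul0r (nval0 hw) ltey.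
  rewrite (nvalM hw) unit_t// add0e (nvalX hw _ wx) lte_fin.
  rewrite !mulNrn ltrN2 ltr_nat ltn_neqAle.
  by rewrite -val_eqE /= in ji; rewrite ji; exact: imax.
by rewrite -E ltxx.
Qed.

(** This treats finite and infinite places alike: tau is t - a or 1/t. *)
Lemma exists_local_uniformizer : exists tau, [/\ tau != 0, (0 < w tau)%E &
  forall p, p != 0 -> exists m : int, exists2 c, c != 0 & residue (at_t p / tau ^ m) c].
Proof.
have [t0|] := ltP (w t) 0%E.
  exists t^-1; have [m wt] := nval_fin hw t_neq0; split.
  - by rewrite invr_eq0 t_neq0.
  - by rewrite (nvalV hw wt) lte_fin oppr_gt0 -lte_fin -wt.
  move=> p p0; exists (- (size p).-1%:Z), (lead_coef p); rewrite ?lead_coef_eq0//.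
  by rewrite exprz_inv opprK; exact: local_form_infty.
move=> /center_finite[a ta]; exists (t - kap a); split => //.
  exact: t_neq_const.
move=> p p0; exists (mup a p)%:Z; exact: local_form_finite.
Qed.

Lemma residue_fraction p q : p != 0 -> q != 0 -> (0 <= w (at_t p / at_t q))%E ->
  exists c, residue (at_t p / at_t q) c.
Proof.
move=> p0 q0; have [tau [tau0 wtau h]] := exists_local_uniformizer.
have [m [a a0 ra]] := h _ p0; have [l [b b0 rb]] := h _ q0.
have rab := residueM hw ra (residueV hw rb b0).
have E : at_t p / at_t q = tau ^ (m - l) * (at_t p / tau ^ m / (at_t q / tau ^ l)).
  rewrite expfzDr// -invr_expz invf_div; set x := tau ^ m; set y := tau ^ l.
  have x0 : x != 0 by rewrite expfz_neq0.
  have y0 : y != 0 by rewrite expfz_neq0.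
  have q0' : at_t q != 0 by rewrite at_t_eq0.
  by move: (at_t p) (at_t q) q0' => f g g0; field; rewrite x0 y0 g0.
have [v wv] := nval_fin hw tau0.
rewrite E (nvalM hw) (residue_neq0 hw rab) ?mulf_neq0 ?invr_eq0// adde0.
rewrite (nvalXz hw _ wv) lee_fin; rewrite wv lte_fin in wtau.
rewrite -mulrzr intz pmulr_rge0// subr_ge0 le_eqVlt => /orP[lm|ml].
  have -> : m - l = 0 by rewrite (eqP lm) subrr.
  by rewrite expr0z mul1r; eexists; exact: rab.
exists 0; rewrite (residue0 kap); apply: (nval_mulgt0l hw); last exact: residue_ge0 rab.
by rewrite (nvalXz hw _ wv) lte_fin -mulrzr intz pmulr_rgt0// subr_gt0.
Qed.

(** The residue field is algebraic over k: a relation over k[t] between the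
    powers of x, divided by its coefficient of least value and reduced modulo
    w, is a nonzero polynomial over k that vanishes at the residue of x. *)
Lemma residue_exists x : (0 <= w x)%E -> exists c, residue x c.
Proof.
move=> x0; have [p [[i1 pi1]]] := K_dep (fun i => x ^+ i).
pose v i := fine (w (at_t (p i))).
have vE i : p i != 0 -> w (at_t (p i)) = (v i)%:E.
  by rewrite -at_t_eq0 => /(nval_fin hw)[m]; rewrite /v => ->.
have [i pi imin] := @Order.TotalTheory.arg_minP _ _ _ i1 (fun i => p i != 0) v pi1.
move=> /(congr1 ( *%R^~ (at_t (p i))^-1)); rewrite mul0r mulr_suml => E.
have : forall j, exists c, residue (at_t (p j) / at_t (p i)) c.
  move=> j; have [pj0|pj0] := eqVneq (p j) 0.
    by exists 0; rewrite pj0 rmorph0 mul0r (residue0 kap) (nval0 hw) ltey.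
  apply: residue_fraction => //.
  by rewrite (nvalM hw) (nvalV hw (vE _ pi)) vE// -EFinD lee_fin subr_ge0 imin.
move=> /choice[c rc].
have ci : c i = 1.
  apply: (residue_uniq hw (rc i)); rewrite divff ?at_t_eq0//.
  by rewrite -(rmorph1 kap) residue_const.
pose q := \poly_(j < d.+1) c (inord j).
have q0 : q != 0.
  apply/eqP => /(congr1 (fun q : {poly k} => q`_i)); rewrite coef_poly ltn_ord inord_val ci coef0.
  by apply/eqP; exact: oner_neq0.
suff /(nval_poly_gt0 hw q0)[a _ ra] : (0 < w (map_poly kap q).[x])%E by exists a.
have -> : (map_poly kap q).[x] = \sum_(j < d.+1) - ((at_t (p j) / at_t (p i) - kap (c j)) * x ^+ j).
  rewrite sumrN; under [in RHS]eq_bigr do rewrite mulrBl; rewrite sumrB.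
  under [X in - (X - _)]eq_bigr do rewrite mulrAC; rewrite E sub0r opprK.
  rewrite (@horner_coef_wide _ d.+1); last first.
    by rewrite size_map_poly size_poly.
  by apply: eq_bigr => j _; rewrite coef_map coef_poly ltn_ord inord_val.
apply: (nval_sumlt hw) => j _; rewrite (nvalN hw).
by apply: (nval_mulgt0l hw); [exact: rc|exact: nval_geX0].
Qed.

End At_valuation.
End FunctionField.

(** * Valuation rings from maximal subrings *)

Section Chevalley.
Variables (K : fieldType) (z : K).

(** Zorn's lemma, applied to the sets X such that the union of X and B is a
    subring without z; joining B to X makes the empty chain harmless. *)
Lemma exists_maximal_subring (B : subringClosed K) : z \notin B ->
  exists A : subringClosed K, [/\ {subset B <= A}, z \notin A &
    forall T : subringClosed K, {subset A <= T} -> z \notin T -> {subset T <= A}].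
Proof.
move=> zB.
pose U (X : set K) : {pred K} := fun x => `[< X x >] || (x \in B).
pose P (X : set K) := subring_closed (U X) /\ z \notin U X.
have [F FP Ftot|X [[Xring zX] Xmax]] := @Zorn_bigcup K P.
  have common x y : x \in U (\bigcup_(X in F) X) -> y \in U (\bigcup_(X in F) X) ->
      exists C : {pred K}, [/\ subring_closed C, x \in C, y \in C &
        {subset C <= U (\bigcup_(X in F) X)}].
    have sub X : F X -> {subset U X <= U (\bigcup_(X in F) X)}.
      move=> FX a /orP[/asboolP Xa|aB]; apply/orP; last by right.
      by left; apply/asboolP; exists X.
    move=> /orP[/asboolP[X1 FX1 X1x]|xB] /orP[/asboolP[X2 FX2 X2y]|yB].
    - have [le|le] := Ftot _ _ FX1 FX2.
        exists (U X2); split; [exact: (FP _ FX2).1| | |exact: sub].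
          by apply/orP; left; apply/asboolP/le.
        by apply/orP; left; apply/asboolP.
      exists (U X1); split; [exact: (FP _ FX1).1| | |exact: sub].
        by apply/orP; left; apply/asboolP.
      by apply/orP; left; apply/asboolP/le.
    - exists (U X1); split; [exact: (FP _ FX1).1| | |exact: sub].
        by apply/orP; left; apply/asboolP.
      by apply/orP; right.
    - exists (U X2); split; [exact: (FP _ FX2).1| | |exact: sub].
        by apply/orP; right.
      by apply/orP; left; apply/asboolP.
    - exists (fun x => x \in B); split => //; last by move=> a aB; apply/orP; right.
      by split; [exact: rpred1|exact: rpredB|exact: rpredM].
  split; last first.
    apply/negP => /orP[/asboolP[X FX Xz]|]; last by apply/negP.
    by case: (FP _ FX) => _ /orP; apply; left; apply/asboolP.
  split=> [|x y hx hy|x y hx hy].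
  - by apply/orP; right; exact: rpred1.
  - by have [C [[_ CB _] Cx Cy sub]] := common _ _ hx hy; apply/sub/CB.
  - by have [C [[_ _ CM] Cx Cy sub]] := common _ _ hx hy; apply/sub/CM.
pose A : subringClosed K := HB.pack (U X) (GRing.isSubringClosed.Build K (U X) Xring).
exists A; split => // [x xB|T AT zT x xT]; first by apply/orP; right.
have PT : P [set x | x \in T].
  have UE : U [set x | x \in T] =i T.
    move=> y; apply/orP/idP => [[/asboolP//|yB]|yT]; last by left; apply/asboolP.
    by apply: AT; apply/orP; right.
  split; last by rewrite UE.
  by split=> [|a b|a b]; rewrite !UE; [exact: rpred1|exact: rpredB|exact: rpredM].
apply/orP; left; apply/asboolP; apply: contrapT => Xx.
apply: (Xmax _ _ PT); split; last by move=> /(_ x xT).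
by move=> y Xy /=; apply: AT; apply/orP; left; apply/asboolP.
Qed.

Variables (A : subringClosed K) (zA : z \notin A) (zVA : z^-1 \in A).
Hypothesis A_max : forall T : subringClosed K, {subset A <= T} -> z \notin T -> {subset T <= A}.

(** A[x] is a subring larger than A. *)
Lemma maximal_adjoin x : x \notin A -> exists2 p, p \is a polyOver A & z = p.[x].
Proof.
move=> xA; pose T : {pred K} := fun y => `[< exists2 p, p \is a polyOver A & y = p.[x] >].
have Tring : subring_closed T.
  split=> [|_ _ /asboolP[p pA ->] /asboolP[q qA ->]|_ _ /asboolP[p pA ->] /asboolP[q qA ->]];
    apply/asboolP.
  - by exists 1; rewrite ?hornerE ?rpred1.
  - by exists (p - q); rewrite ?hornerE ?rpredB.
  - by exists (p * q); rewrite ?hornerE ?rpredM.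
pose TT : subringClosed K := HB.pack T (GRing.isSubringClosed.Build K T Tring).
apply: contrapT => zT; move/negP: xA; apply; apply: (A_max (T := TT)).
- by move=> a aA; apply/asboolP; exists a%:P; rewrite ?hornerE ?polyOverC.
- by apply/negP => /asboolP.
- by apply/asboolP; exists 'X; rewrite ?hornerE ?polyOverX.
Qed.

Lemma z_neq0 : z != 0.
Proof. by apply: contraNneq zA => ->; exact: rpred0. Qed.

(** This says that z^-1 lies in the Jacobson radical of A. If u = 1 - z^-1 b had
    no inverse in A, then z would lie in A[u^-1], so that z u^m would lie in A
    for some m; but u^m is 1 modulo z^-1 A, so z u^m is z modulo A. *)
Lemma maximal_unit b : b \in A -> (1 - z^-1 * b)^-1 \in A.
Proof.
move=> bA; set u := 1 - _; have z0 := z_neq0.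
have u0 : u != 0.
  rewrite subr_eq0; apply: contraNneq zA => E.
  by rewrite -[z]mulr1 E mulrA mulfV// mul1r.
apply/negPn/negP => /maximal_adjoin[p pA zE].
have uA : u \in A by rewrite rpredB ?rpred1 ?rpredM.
have upow n : exists2 b', b' \in A & u ^+ n = 1 - z^-1 * b'.
  elim: n => [|n [b' b'A IH]]; first by exists 0; rewrite ?rpred0// mulr0 subr0.
  exists (b' + b - z^-1 * b * b'); first by rewrite rpredB ?rpredD ?rpredM.
  by rewrite exprS IH /u; ring.
have [b' b'A uE] := upow (size p).
have : z * u ^+ size p \in A.
  rewrite zE horner_coef mulr_suml rpred_sum// => i _.
  rewrite exprVn -mulrA rpredM ?(polyOverP pA)//.
  have -> : u ^+ size p = u ^+ i * u ^+ (size p - i) by rewrite -exprD subnKC // ltnW.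
  by rewrite mulKf ?expf_neq0 ?rpredX.
rewrite uE mulrBr mulr1 mulrA mulfV// mul1r => h.
by move/negP: zA; apply; rewrite -(subrK b' z) rpredD.
Qed.

(** Chevalley's argument: if neither x nor x^-1 lies in A, then z is a
    polynomial in each of them. The one of smaller degree, solved for its top
    power by means of [maximal_unit], lowers the degree of the other. *)
Lemma maximal_valuation_ring x : x \in A \/ x^-1 \in A.
Proof.
have z0 := z_neq0.
suff main n : forall (x : K) (p q : {poly K}),
    (size p + size q <= n)%N -> (size q <= size p)%N -> x != 0 ->
    p \is a polyOver A -> q \is a polyOver A -> z = p.[x] -> z = q.[x^-1] -> False.
  have [xA|xA] := boolP (x \in A); first by left.
  have [xVA|xVA] := boolP (x^-1 \in A); first by right.
  have x0 : x != 0 by apply: contraNneq xA => ->; exact: rpred0.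
  have [p pA pE] := maximal_adjoin xA; have [q qA qE] := maximal_adjoin xVA.
  have [le|/ltnW le] := leqP (size q) (size p).
    by case: (main _ _ _ _ (leqnn _) le x0 pA qA pE qE).
  rewrite -[x]invrK in pE.
  by case: (main _ _ _ _ (leqnn _) le (invr_neq0 x0) qA pA qE pE).
elim: n {x} => [|n IH] x p q.
  rewrite leqn0 addn_eq0 size_poly_eq0 => /andP[/eqP -> _] _ _ _ _ zE _.
  by move: z0; rewrite zE horner0 eqxx.
move=> szn szqp x0 pA qA pE qE.
have [m szq] : exists m, size q = m.+2.
  case E : (size q) => [|[|m]]; last by exists m.
    move/eqP: E; rewrite size_poly_eq0 => /eqP E.
    by move: z0; rewrite qE E horner0 eqxx.
  move/negP: zA; case; rewrite qE (size1_polyC (eq_leq E)) hornerC.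
  exact: (polyOverP qA).
have [l szp] : exists l, size p = (l + m.+2)%N.
  by exists (size p - m.+2)%N; rewrite subnK// -szq.
pose v := (1 - z^-1 * q`_0)^-1; have vA : v \in A.
  by apply: maximal_unit; exact: (polyOverP qA).
have u0 : 1 - z^-1 * q`_0 != 0.
  rewrite subr_eq0; apply: contraNneq zA => E.
  by rewrite -[z]mulr1 E mulrA mulfV// mul1r; exact: (polyOverP qA).
(* solving z = q(x^-1) for x^(m+1): the unit 1 - z^-1 q_0 multiplies it *)
pose r := \poly_(i < m.+1) (v * z^-1 * q`_(m.+1 - i)).
have rA : r \is a polyOver A.
  apply/polyOverP => i; rewrite coef_poly; case: ifP => _; last exact: rpred0.
  by rewrite rpredM ?rpredM// (polyOverP qA).
have rE : r.[x] = x ^+ m.+1.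
  have : (1 - z^-1 * q`_0) * x ^+ m.+1 = z^-1 * \sum_(i < m.+1) q`_(m.+1 - i) * x ^+ i.
    have : z^-1 * z * x ^+ m.+1 = z^-1 * (q.[x^-1] * x ^+ m.+1) by rewrite -mulrA {2}qE.
    rewrite mulVf// mul1r horner_coef szq big_ord_recl expr0 mulr1 mulrDl mulrDr.
    move=> /eqP; rewrite mulrA [X in _ == X]addrC -subr_eq -{1}[x ^+ _]mul1r -mulrBl => /eqP ->.
    congr (_ * _); rewrite mulr_suml (reindex_inj rev_ord_inj) /=.
    apply: eq_bigr => i _; rewrite /bump leq0n add1n subSS subSn ?leq_subr//; last first.
      by rewrite -ltnS.
    rewrite -mulrA; congr (_ * _); rewrite exprVn.
    have E : (m.+1 = (m - i).+1 + i)%N by rewrite addSn subnK// -ltnS.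
    by rewrite {2}E exprD mulKf// expf_neq0.
  move=> /(canRL (mulKf u0)) ->; rewrite horner_poly mulrA mulr_sumr.
  by apply: eq_bigr => i _; rewrite -!mulrA.
(* replace the top power of p by means of x^(m+1) = r(x) *)
pose p' := p - p`_(l + m.+1) *: ('X^l * ('X^(m.+1) - r)).
have p'A : p' \is a polyOver A.
  rewrite rpredB// polyOverZ ?(polyOverP pA)//.
  by rewrite rpredM ?rpredB ?rpredX ?polyOverX.
have p'E : z = p'.[x].
  rewrite hornerD hornerN hornerZ hornerM hornerD hornerN rE !hornerXn.
  by rewrite subrr !mulr0 subr0.
have szp' : (size p' <= l + m.+1)%N.
  apply/leq_sizeP => j lej; rewrite coefB coefZ coefXnM.
  have -> : (j < l)%N = false by apply/negbTE; rewrite -leqNgt (leq_trans _ lej)// leq_addr.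
  rewrite coefB coefXn coef_poly.
  have ljm : (m.+1 <= j - l)%N by rewrite leq_subRL ?(leq_trans _ lej)// leq_addr.
  rewrite ltnNge ljm /= subr0; have [E|ne] := eqVneq (j - l)%N m.+1.
    by rewrite mulr1 -E subnKC ?subrr// (leq_trans _ lej)// leq_addr.
  rewrite mulr0 subr0 nth_default// szp addnS ltn_neqAle lej andbT.
  by apply: contra ne => /eqP <-; rewrite addKn.
have sz' : (size p' + size q <= n)%N.
  by rewrite -ltnS (leq_trans _ szn)// ltn_add2r szp addnS ltnS.
have [le|/ltnW le] := leqP (size q) (size p').
  exact: (IH _ _ _ sz' le x0 p'A qA p'E qE).
rewrite addnC in sz'; rewrite -[x]invrK in p'E.
exact: (IH _ _ _ sz' le (invr_neq0 x0) qA p'A qE p'E).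
Qed.

End Chevalley.

(** * The discrete valuation of a valuation ring *)

Section Discrete.
Variables (k : closedFieldType) (K : fieldType) (kap : {rmorphism k -> K}) (t : K).
Local Notation at_t := (at_t kap t).
Hypothesis t_trans : injective at_t.
Variables (d : nat) (K_dep : dependent_over kap t d).
Variables (A : subringClosed K) (A_val : forall x, x \in A \/ x^-1 \in A).
Hypothesis A_const : forall c, kap c \in A.
Variables (z : K) (zA : z \notin A).

Definition runit x := [&& x != 0, x \in A & x^-1 \in A].

Lemma runitM x y : runit x -> runit y -> runit (x * y).
Proof.
move=> /and3P[x0 xA xVA] /and3P[y0 yA yVA].
by rewrite /runit mulf_neq0// invfM !rpredM.
Qed.

Lemma runitV x : runit x -> runit x^-1.
Proof. by move=> /and3P[x0 xA xVA]; rewrite /runit invr_eq0 invrK x0 xA xVA. Qed.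

Lemma runit1 : runit 1.
Proof. by rewrite /runit oner_neq0 invr1 !rpred1. Qed.

Lemma runitX x n : runit x -> runit (x ^+ n).
Proof. by move=> hx; elim: n => [|n IH]; rewrite ?expr0 ?runit1// exprS runitM. Qed.

Lemma runit_const c : c != 0 -> runit (kap c).
Proof. by move=> c0; rewrite /runit fmorph_eq0 c0 -fmorphV !A_const. Qed.

Lemma runit_prod (I : Type) (s : seq I) (F : I -> K) :
  (forall i, runit (F i)) -> runit (\prod_(i <- s) F i).
Proof.
move=> h; apply: (@big_ind _ (fun x => runit x)) => //.
  exact: runit1.
exact: runitM.
Qed.

Definition nonunit x := (x \in A) && ~~ runit x.

Lemma nonunit0 : nonunit 0.
Proof. by rewrite /nonunit /runit eqxx rpred0. Qed.

Lemma nonunitM x y : nonunit x -> y \in A -> nonunit (x * y).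
Proof.
move=> /andP[xA xU] yA; rewrite /nonunit rpredM//=; apply: contra xU.
move=> /and3P[]; rewrite mulf_eq0 negb_or => /andP[x0 y0] _ h.
rewrite /runit x0 xA /=; have -> : x^-1 = y * (x * y)^-1 by field; rewrite x0 y0.
by rewrite rpredM.
Qed.

Lemma nonunitD x y : nonunit x -> nonunit y -> nonunit (x + y).
Proof.
have [->|x0] := eqVneq x 0; first by rewrite add0r.
have [->|y0] := eqVneq y 0; first by rewrite addr0.
move=> hx hy; have [h|h] := A_val (x / y).
  have -> : x + y = y * (x / y + 1) by field.
  by rewrite nonunitM// rpredD ?rpred1.
have -> : x + y = x * ((x / y)^-1 + 1) by field; rewrite x0 y0.
by rewrite nonunitM// rpredD ?rpred1.
Qed.

Lemma nonunit_sum (I : finType) (P : pred I) (F : I -> K) :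
  (forall i, P i -> nonunit (F i)) -> nonunit (\sum_(i | P i) F i).
Proof.
move=> h; apply: (@big_ind _ (fun x => nonunit x)) => //.
  exact: nonunit0.
exact: nonunitD.
Qed.

Lemma runitP x : runit x -> ~ nonunit x.
Proof. by move=> h /andP[_]; rewrite h. Qed.

(** The nonunits form an ideal, which contains no nonzero constant. *)
Lemma runit_addl c x : c != 0 -> nonunit x -> runit (kap c + x).
Proof.
move=> c0 hx; apply/negPn/negP => h.
have /andP[xA _] := hx.
have hcx : nonunit (kap c + x) by rewrite /nonunit h rpredD.
apply: (@runitP (kap c)); first exact: runit_const.
rewrite -(addrK x (kap c)) nonunitD// -mulrN1 nonunitM// rpredN rpred1 //.
Qed.

Lemma nonunitV x : x \notin A -> nonunit x^-1.
Proof.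
move=> xA; have [/(negP xA)//|h] := A_val x.
by rewrite /nonunit h /runit invrK (negPf xA) !andbF.
Qed.

Lemma at_t_mem p : t \in A -> at_t p \in A.
Proof.
by move=> tA; rewrite at_t_sum rpred_sum// => i _; rewrite rpredM ?A_const// rpredX.
Qed.

(** Otherwise A would contain k(t), and z would be integral over A. *)
Lemma exists_nonunit : t \in A -> exists a, nonunit (t - kap a).
Proof.
move=> tA; apply: contrapT => noroot.
have unit_t p : p != 0 -> runit (at_t p).
  move=> p0; have [rs ->] := closed_field_poly_normal p.
  rewrite at_tE map_polyZ hornerZ rmorph_prod horner_prod.
  apply: runitM; first by rewrite runit_const// lead_coef_eq0.
  apply: runit_prod => a; apply/negPn/negP => h; apply: noroot; exists a.
  by rewrite -at_tXsubC /nonunit at_t_mem//.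
have z0 : z != 0 by apply: contraNneq zA => ->; exact: rpred0.
have zVA : z^-1 \in A by have /andP[] := nonunitV zA.
have [p [[i1 pi1]]] := K_dep (fun i => z ^+ i).
have [i pi imax] := @arg_maxnP _ i1 (fun i => p i != 0) (fun i : 'I_d.+1 => i : nat) pi1.
have /and3P[_ _ piV] := unit_t _ pi.
rewrite (bigD1 i)//= => /eqP; rewrite addr_eq0 => /eqP E.
have {}E : z = - \sum_(j < d.+1 | j != i) at_t (p j) * (at_t (p i))^-1 * (z ^+ j / z ^+ i * z).
  have pit : at_t (p i) != 0 by rewrite at_t_eq0.
  transitivity ((at_t (p i) * z ^+ i) * ((at_t (p i))^-1 / z ^+ i * z)).
    by field; rewrite expf_neq0// pit.
  rewrite E mulNr mulr_suml; congr (- _); apply: eq_bigr => j _.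
  by field; rewrite expf_neq0// pit.
move/negP: zA; apply; rewrite E rpredN rpred_sum// => j ji.
have [pj0|pj0] := eqVneq (p j) 0; first by rewrite pj0 rmorph0 !mul0r rpred0.
have ji' : (j < i)%N by rewrite ltn_neqAle; apply/andP; split=> //; exact: imax.
apply: rpredM; first by rewrite rpredM ?at_t_mem.
have -> : z ^+ j / z ^+ i * z = z^-1 ^+ (i - j).-1.
  have -> : z ^+ i = z ^+ j * (z ^+ (i - j).-1 * z).
    by rewrite -exprSr prednK ?subn_gt0// -exprD subnKC// ltnW.
  by rewrite exprVn; field; rewrite z0 !expf_neq0.
exact: rpredX.
Qed.

(** A meets k(t) in the local ring of a place, and tau is t - a or 1/t. *)
Lemma exists_ring_uniformizer : exists tau, [/\ tau != 0, nonunit tau &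
  forall p, p != 0 -> exists m : int, runit (at_t p / tau ^ m)].
Proof.
have [tA|tA] := boolP (t \in A); last first.
  have t0 : t != 0 by apply: contraNneq tA => ->; exact: rpred0.
  exists t^-1; split; rewrite ?invr_eq0//; first exact: nonunitV.
  move=> p p0; exists (- (size p).-1%:Z); rewrite exprz_inv opprK.
  have sp : size p = (size p).-1.+1 by rewrite prednK// size_poly_gt0.
  rewrite at_t_sum sp big_ord_recr /= mulrDl mulfK ?expf_neq0// addrC.
  apply: runit_addl; first by rewrite -lead_coefE lead_coef_eq0.
  rewrite mulr_suml; apply: nonunit_sum => i _.
  rewrite -mulrA mulrC; apply: nonunitM; last exact: A_const.
  have -> : t ^+ i / t ^+ (size p).-1 = t^-1 * t^-1 ^+ ((size p).-1 - i).-1.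
    have -> : t ^+ (size p).-1 = t ^+ i * (t ^+ ((size p).-1 - i).-1 * t).
      by rewrite -exprSr prednK ?subn_gt0// -exprD subnKC// ltnW.
    by rewrite exprVn; field; rewrite t0 !expf_neq0.
  apply: nonunitM; first exact: nonunitV.
  by rewrite rpredX//; have /andP[] := nonunitV tA.
have [a ha] := exists_nonunit tA; exists (t - kap a); split=> //.
  exact: t_neq_const.
move=> p p0; have [m [q]] := multiplicity_XsubC p a.
rewrite p0 /= => qa ->; exists m%:Z.
rewrite rmorphM rmorphXn /= at_tXsubC mulfK ?expf_neq0 ?t_neq_const//.
have [g gE] : exists g, q - q.[a]%:P = g * ('X - a%:P).
  by apply/factor_theorem; rewrite rootE !hornerE subrr.
have -> : q = q.[a]%:P + g * ('X - a%:P) by rewrite -gE addrC subrK.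
rewrite rmorphD rmorphM /= at_tXsubC at_tC; apply: runit_addl; first by rewrite -rootE.
by rewrite mulrC nonunitM// at_t_mem.
Qed.

(** Divisibility in a valuation ring is a total preorder. *)
Lemma dominant_mem (s : seq K) x0 : x0 \in s -> (forall x, x \in s -> x != 0) ->
  exists2 y, y \in s & forall x, x \in s -> x / y \in A.
Proof.
elim: s x0 => // a s IH x0 _ s0.
case: s IH s0 => [|b s] IH s0.
  exists a; rewrite ?mem_head// => x; rewrite inE => /eqP ->.
  by rewrite divff ?rpred1// s0 ?mem_head.
have [x xs|y ys hy] := IH b (mem_head _ _); first by apply: s0; rewrite inE xs orbT.
have y0 : y != 0 by apply: s0; rewrite inE ys orbT.
have a0 : a != 0 by apply: s0; rewrite mem_head.
have [h|h] := A_val (a / y).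
  exists y; first by rewrite in_cons ys orbT.
  by move=> x /predU1P[->//|]; exact: hy.
exists a; rewrite ?mem_head// => x /predU1P[->|/hy xy]; first by rewrite divff ?rpred1.
have -> : x / a = x / y * (a / y)^-1 by field; rewrite a0 y0.
by rewrite rpredM.
Qed.

Section Uniformizing.
Variables (tau : K) (tau0 : tau != 0) (tau_nonunit : nonunit tau).
Hypothesis tau_form : forall p, p != 0 -> exists m : int, runit (at_t p / tau ^ m).

(** In a relation over k[t] between the powers of x, two terms must be associate,
    since a single dominant term could not cancel. Their quotient is a power of
    x up to a unit and a power of tau. *)
Lemma runit_power x : x != 0 ->
  exists i n, [/\ (0 < i)%N, (i <= d)%N & runit (x ^+ i / tau ^ n)].
Proof.
move=> x0; have [p [[i1 pi1]]] := K_dep (fun i => x ^+ i).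
pose T i := at_t (p i) * x ^+ i; rewrite -/(\sum_i T i) => sumT.
have T0 i : (T i == 0) = (p i == 0).
  by rewrite mulf_eq0 at_t_eq0// expf_eq0 (negPf x0) andbF orbF.
have [|y|y] := @dominant_mem [seq T i | i <- enum 'I_d.+1 & p i != 0] (T i1).
- by apply: map_f; rewrite mem_filter pi1 mem_enum.
- by move=> /mapP[i]; rewrite mem_filter => /andP[pi _] ->; rewrite T0.
move=> /mapP[i]; rewrite mem_filter => /andP[pi _] -> hT.
have Ti0 : T i != 0 by rewrite T0.
have [j ji Uj] : exists2 j, j != i & runit (T j / T i).
  apply: contrapT => no; apply: (@runitP (-1)).
    by rewrite /runit oppr_eq0 oner_neq0 invrN invr1 rpredN rpred1.
  have -> : -1 = \sum_(j | j != i) T j / T i.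
    apply/eqP; rewrite -mulr_suml eq_sym -addr_eq0.
    have -> : \sum_(j | j != i) T j = - T i.
      by move: sumT; rewrite (bigD1 i)//= addrC => /eqP; rewrite addr_eq0 => /eqP.
    by rewrite mulNr divff// addNr.
  apply: nonunit_sum => j ji.
  have [pj|pj] := eqVneq (p j) 0.
    by have /eqP -> : T j == 0; rewrite ?T0 ?pj// mul0r nonunit0.
  rewrite /nonunit hT; last by apply: map_f; rewrite mem_filter pj mem_enum.
  by apply/negP => h; apply: no; exists j.
have pj : p j != 0.
  by move: Uj => /and3P[]; rewrite mulf_eq0 T0 negb_or => /andP[].
have [mi ui] := tau_form pi; have [mj uj] := tau_form pj.
have tm m : tau ^ m != 0 by rewrite expfz_neq0.
have {Uj}U : runit (x ^+ j / x ^+ i / tau ^ (mi - mj)).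
  have := runitM Uj (runitM ui (runitV uj)); congr runit.
  have [pi' pj'] : at_t (p i) != 0 /\ at_t (p j) != 0 by rewrite !at_t_eq0.
  rewrite /T expfzDr// -invr_expz; field.
  by rewrite pi' pj' !tm !expf_neq0.
have [lt|lt|E] := ltngtP j i; last by move: ji; rewrite -val_eqE /= E eqxx.
- exists (i - j)%N, (mj - mi); split; first by rewrite subn_gt0.
    by rewrite (leq_trans (leq_subr _ _))// -ltnS.
  have := runitV U; congr runit.
  have -> : x ^+ i = x ^+ j * x ^+ (i - j) by rewrite -exprD subnKC// ltnW.
  rewrite !expfzDr// -!invr_expz; field.
  by rewrite !tm !expf_neq0.
- exists (j - i)%N, (mi - mj); split; first by rewrite subn_gt0.
    by rewrite (leq_trans (leq_subr _ _))// -ltnS.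
  move: U; congr runit.
  have -> : x ^+ j = x ^+ i * x ^+ (j - i) by rewrite -exprD subnKC// ltnW.
  rewrite !expfzDr// -!invr_expz; field.
  by rewrite !tm !expf_neq0.
Qed.

(** A multiple of every exponent allowed by [runit_power] serves all x at once. *)
Lemma runit_fact x : x != 0 -> exists n, runit (x ^+ d`! / tau ^ n).
Proof.
move=> /runit_power[i [n [i0 id U]]].
have /dvdnP[q qE] : (i %| d`!)%N by rewrite dvdn_fact// i0.
exists (n * q%:Z); have := runitX q U; congr runit.
by rewrite expr_div_n -exprM mulnC -qE -exprz_exp.
Qed.

Lemma tau_pow_mem n : (tau ^ n \in A) = (0 <= n).
Proof.
have /andP[tA tU] := tau_nonunit.
apply/idP/idP; last by case: n => // n _; exact: rpredX.
rewrite leNgt => h; apply/negP; case: n h => // n h _.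
move/negP: tU; apply; rewrite /runit tau0 tA /=.
rewrite NegzE -invr_expz in h.
have -> : tau^-1 = tau ^+ n * (tau ^ n.+1)^-1.
  by rewrite -exprnP exprS; field; rewrite tau0 expf_neq0.
by rewrite rpredM// rpredX.
Qed.

Lemma runit_uniq x n m : runit (x / tau ^ n) -> runit (x / tau ^ m) -> n = m.
Proof.
move=> hn hm.
have tm l : tau ^ l != 0 by rewrite expfz_neq0.
have x0 : x != 0 by move: hn => /and3P[]; rewrite mulf_eq0 negb_or => /andP[].
have h a b : runit (x / tau ^ a) -> runit (x / tau ^ b) -> a <= b.
  move=> ha hb; have /and3P[_ h _] := runitM ha (runitV hb).
  rewrite -subr_ge0 -tau_pow_mem; move: h; congr (_ \in A).
  by rewrite expfzDr// -invr_expz; field; rewrite x0 !tm.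
by apply/eqP; rewrite eq_le !h.
Qed.

(** The exponents n of [runit_fact] form a homomorphism from K^* to the integers
    that is nonnegative exactly on A. Division by the generator of its image
    makes it surjective. *)
Lemma exists_valuation_of_ring : exists2 w, normalized_valuation w &
  forall x, x != 0 -> (0 <= w x)%E -> x \in A.
Proof.
have z0 : z != 0 by apply: contraNneq zA => ->; exact: rpred0.
have tm l : tau ^ l != 0 by rewrite expfz_neq0.
have [nu nuP] : exists nu : K -> int, forall x, x != 0 -> runit (x ^+ d`! / tau ^ nu x).
  have [|nu h] := @choice _ _ (fun x n => x != 0 -> runit (x ^+ d`! / tau ^ n)); last by exists nu.
  move=> x; have [->|x0] := eqVneq x 0; first by exists 0.
  by have [n h] := runit_fact x0; exists n.
have nuM x y : x != 0 -> y != 0 -> nu (x * y) = nu x + nu y.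
  move=> x0 y0; apply: (@runit_uniq ((x * y) ^+ d`!)); first by rewrite nuP// mulf_neq0.
  have := runitM (nuP _ x0) (nuP _ y0); congr runit.
  by rewrite exprMn expfzDr//; field; rewrite !tm.
have nuA x : x != 0 -> (0 <= nu x) = (x \in A).
  move=> x0; have := nuP _ x0 => /and3P[_ h1 h2]; apply/idP/idP => [h|xA].
    have [//|xV] := A_val x.
    have -> : x = x ^+ d`! / tau ^ nu x * tau ^ nu x * x^-1 ^+ (d`!.-1).
      rewrite divfK// -{1 2}(prednK (fact_gt0 d)) exprS exprVn.
      by rewrite mulfK// expf_neq0.
    by apply: rpredM; [rewrite rpredM ?tau_pow_mem|rewrite rpredX].
  rewrite -tau_pow_mem.
  have -> : tau ^ nu x = (x ^+ d`! / tau ^ nu x)^-1 * x ^+ d`!.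
    by field; rewrite tm expf_neq0.
  by rewrite rpredM// rpredX.
have nu1 : nu 1 = 0.
  have := nuM _ _ (oner_neq0 K) (oner_neq0 K); rewrite mulr1 => /eqP.
  by rewrite -subr_eq0 opprD addNKr oppr_eq0 => /eqP.
have nuV x : x != 0 -> nu x^-1 = - nu x.
  move=> x0; apply/eqP; rewrite -addr_eq0 -nuM ?invr_eq0// mulVf//; exact/eqP.
have nuX x n : x != 0 -> nu (x ^+ n) = nu x *+ n.
  move=> x0; elim: n => [|n IH]; first by rewrite expr0.
  by rewrite exprS nuM ?expf_neq0// IH mulrS.
have nuXz x n : x != 0 -> nu (x ^ n) = nu x * n.
  move=> x0; case: n => n; first by rewrite -exprnP nuX// -mulr_natr natz.
  by rewrite NegzE -invr_expz nuV ?expfz_neq0// -exprnP nuX// mulrN -mulr_natr natz.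
have ex : exists n : nat, `[< exists2 x, x != 0 & nu x = n.+1%:Z >].
  have : 0 < nu z^-1 by rewrite nuV// oppr_gt0 ltNge nuA.
  case E : (nu z^-1) => [[|n]|] // _.
  by exists n; apply/asboolP; exists z^-1; rewrite ?invr_eq0.
have [g /asboolP[pi pi0 pig] gmin] := ex_minnP ex.
have gdvd y : y != 0 -> nu y = (nu y %/ g.+1)%Z * g.+1%:Z.
  move=> y0; rewrite {1}(divz_eq (nu y) g.+1).
  have r0 : 0 <= (nu y %% g.+1)%Z by rewrite modz_ge0.
  have rlt : (nu y %% g.+1)%Z < g.+1%:Z by rewrite ltz_pmod.
  have rE : nu (y * pi ^ (- (nu y %/ g.+1)%Z)) = (nu y %% g.+1)%Z.
    rewrite nuM ?expfz_neq0// nuXz// pig {1}(divz_eq (nu y) g.+1).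
    by rewrite mulrN mulrC addrC mulrC addKr.
  case E : (nu y %% g.+1)%Z r0 rlt rE => [[|n]|] // _ nlt rE; first by rewrite addr0.
  have gn : (g <= n)%N.
    apply: gmin; apply/asboolP; eexists; last exact: rE.
    by rewrite mulf_neq0// expfz_neq0.
  by move: nlt; rewrite ltz_nat ltnS ltnNge gn.
pose w x : \bar int := if x == 0 then +oo%E else (nu x %/ g.+1)%Z%:E.
have wE x : x != 0 -> w x = (nu x %/ g.+1)%Z%:E by rewrite /w => /negPf ->.
have g0 : (0 : int) < g.+1%:Z by [].
exists w; last by move=> x x0; rewrite wE// lee_fin -nuA// divz_ge0.
split.
- by move=> x; rewrite /w; case: (x == 0); rewrite ?eqxx.
- by move=> x; rewrite /w; case: (x == 0).
- move=> x y; have [->|x0] := eqVneq x 0.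
    by rewrite mul0r /w eqxx; case: eqP.
  have [->|y0] := eqVneq y 0; first by rewrite mulr0 /w eqxx (negPf x0).
  rewrite !wE ?mulf_neq0// -EFinD nuM// (gdvd _ x0) (gdvd _ y0) -mulrDl.
  by rewrite !mulzK.
- have nu_addl x y : x != 0 -> y != 0 -> x + y != 0 -> nu x <= nu y -> nu x <= nu (x + y).
    move=> x0 y0 xy0 le; have yx : y / x \in A.
      by rewrite -nuA ?mulf_neq0 ?invr_eq0// nuM ?invr_eq0// nuV// subr_ge0.
    have E : x + y = x * (1 + y / x) by field.
    have n0 : 1 + y / x != 0 by apply: contraNneq xy0 => n0; rewrite E n0 mulr0.
    by rewrite E nuM// lerDl nuA// rpredD ?rpred1.
  move=> x y; have [->|x0] := eqVneq x 0; first by rewrite add0r ge_min lexx orbT.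
  have [->|y0] := eqVneq y 0; first by rewrite addr0 ge_min lexx.
  have [xy0|xy0] := eqVneq (x + y) 0; first by rewrite {3}/w xy0 eqxx leey.
  rewrite !wE// ge_min !lee_fin !lez_divRL// -!gdvd//.
  have [le|/ltW le] := leP (nu x) (nu y); first by rewrite nu_addl.
  by rewrite orbC addrC nu_addl// addrC.
- move=> m; exists (pi ^ m).
  by rewrite wE ?expfz_neq0// nuXz// pig mulKz.
Qed.

End Uniformizing.

Lemma valuation_of_ring : exists2 w, normalized_valuation w &
  forall x, x != 0 -> (0 <= w x)%E -> x \in A.
Proof.
have [tau [tau0 tau_n tau_form]] := exists_ring_uniformizer.
exact: exists_valuation_of_ring tau_form.
Qed.

End Discrete.

(** * Existence, approximation and finiteness of places *)

Section Existence.
Variables (k : closedFieldType) (K : fieldType) (kap : {rmorphism k -> K}) (t : K).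
Hypothesis t_trans : injective (at_t kap t).
Variables (d : nat) (K_dep : dependent_over kap t d).

(** As z is not algebraic over k, it does not lie in k[z^-1]; a maximal subring
    that contains k[z^-1] but not z is a valuation ring. *)
Lemma exists_pole z : (forall c, z != kap c) ->
  exists2 w, normalized_valuation w & (w z < 0)%E.
Proof.
move=> zk; have z0 : z != 0 by rewrite -(rmorph0 kap).
pose B : {pred K} := fun y => `[< exists p, y = (map_poly kap p).[z^-1] >].
have Bring : subring_closed B.
  split=> [|_ _ /asboolP[p ->] /asboolP[q ->]|_ _ /asboolP[p ->] /asboolP[q ->]]; apply/asboolP.
  - by exists 1; rewrite rmorph1 hornerC.
  - by exists (p - q); rewrite rmorphB hornerD hornerN.
  - by exists (p * q); rewrite rmorphM hornerM.
pose BB : subringClosed K := HB.pack B (GRing.isSubringClosed.Build K B Bring).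
have zB : z \notin BB.
  apply/negP => /asboolP[p pE].
  have q0 : 'X * p - 1 != 0 :> {poly k}.
    apply/eqP => /(congr1 (fun q : {poly k} => q`_0)).
    by rewrite coefB coefXM coef1 coef0 /= sub0r => /eqP; rewrite oppr_eq0 oner_eq0.
  have : root (map_poly kap ('X * p - 1)) z^-1.
    by rewrite rootE rmorphB rmorphM rmorph1 /= map_polyX !hornerE -pE mulVf// subrr.
  have [rs ->] := closed_field_poly_normal ('X * p - 1).
  rewrite map_polyZ rmorph_prod rootZ ?fmorph_eq0 ?lead_coef_eq0// /root horner_prod.
  rewrite prodf_seq_eq0 => /hasP[a _] /=.
  rewrite rmorphB /= map_polyX map_polyC !hornerE subr_eq0 => /eqP zE.
  by have := zk a^-1; rewrite fmorphV -zE invrK eqxx.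
have [A [BA zA Amax]] := exists_maximal_subring zB.
have zVA : z^-1 \in A.
  by apply: BA; apply/asboolP; exists 'X; rewrite map_polyX hornerX.
have Aconst c : kap c \in A.
  by apply: BA; apply/asboolP; exists c%:P; rewrite map_polyC hornerC.
have [w hw wA] := valuation_of_ring t_trans K_dep (maximal_valuation_ring zA zVA Amax) Aconst zA.
exists w => //; rewrite ltNge; apply/negP => /(wA _ z0).
exact/negP.
Qed.

Lemma exists_above a : exists2 w, normalized_valuation w & residue kap w t a.
Proof.
have [|w hw wz] := @exists_pole (t - kap a)^-1.
  move=> c; apply/eqP => /(congr1 (fun x => x^-1)); rewrite invrK -fmorphV => /eqP.
  by rewrite subr_eq -rmorphD -subr_eq0 (negPf (t_neq_const t_trans _)).
exists w => //; have [m wm] := nval_fin hw (t_neq_const t_trans a).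
by move: wz; rewrite (nvalV hw wm) /residue wm !lte_fin oppr_lt0.
Qed.

End Existence.

Section WeakApproximation.
Variable K : fieldType.
Implicit Types w : K -> \bar int.

(** The units of w are units of w', so w' is a multiple of w; the factor is 1
    because both value groups are all of Z. *)
Lemma nval_ext w w' : normalized_valuation w -> normalized_valuation w' ->
  (forall x, (0 <= w x)%E -> (0 <= w' x)%E) -> w = w'.
Proof.
move=> hw hw' le; have [pi wpi] : exists pi, w pi = 1%:E by case: hw.
have pi0 : pi != 0.
  by apply/eqP => E; move: wpi; rewrite E (nval0 hw).
have [e epi] := nval_fin hw' pi0.
have unit_le x : w x = 0%E -> w' x = 0%E.
  move=> wx; have x0 : x != 0 by apply/eqP => E; move: wx; rewrite E (nval0 hw).
  have [m wm] := nval_fin hw' x0.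
  have h1 : (0 <= w' x)%E by apply: le; rewrite wx.
  have h2 : (0 <= w' x^-1%R)%E by apply: le; rewrite (nvalV hw wx) oppr0.
  rewrite (nvalV hw' wm) lee_fin oppr_ge0 in h2; rewrite wm lee_fin in h1.
  by rewrite wm; congr EFin; apply/eqP; rewrite eq_le h1 h2.
have main x m : w x = m%:E -> w' x = (e * m)%:E.
  move=> wx; have pim0 : pi ^ m != 0 by rewrite expfz_neq0.
  have : w' (x * (pi ^ m)^-1) = 0%E.
    apply: unit_le; rewrite (nvalM hw) wx (nvalV hw (nvalXz hw m wpi)).
    by rewrite -EFinD -mulrzr mul1r intz subrr.
  move=> E; rewrite -[x](divfK pim0) (nvalM hw') E add0e (nvalXz hw' m epi).
  by rewrite -mulrzr intz.
have e0 : 0 <= e by rewrite -lee_fin -epi le// wpi.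
have [y wy] : exists y, w' y = 1%:E by case: hw'.
have y0 : y != 0 by apply/eqP => E; move: wy; rewrite E (nval0 hw').
have [m wm] := nval_fin hw y0.
have e1 : e = 1.
  have := main _ _ wm; rewrite wy => -[] /esym /eqP.
  case: e e0 {epi main} => // n _ E; congr Posz; apply/eqP.
  by move: (congr1 absz (eqP E)); rewrite abszM /= => /eqP; rewrite muln_eq1 => /andP[].
apply/funext => x; have [->|x0] := eqVneq x 0; first by rewrite (nval0 hw) (nval0 hw').
by have [l wl] := nval_fin hw x0; rewrite (main _ _ wl) e1 mul1r wl.
Qed.

Lemma nval_separate w w' : normalized_valuation w -> normalized_valuation w' ->
  w != w' -> exists x, (0 < w x)%E /\ (w' x < 0)%E.
Proof.
move=> hw hw' ww'.
have half (v v' : K -> \bar int) : normalized_valuation v -> normalized_valuation v' -> v != v' ->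
    exists x, (0 <= v x)%E /\ (v' x < 0)%E.
  move=> hv hv' /eqP ne; apply: contrapT => no; apply: ne.
  apply: (nval_ext hv hv') => x vx; rewrite leNgt; apply/negP => v'x.
  by apply: no; exists x.
have [x [wx w'x]] := half _ _ hw hw' ww'.
have [y [w'y wy]] : exists y, (0 <= w' y)%E /\ (w y < 0)%E.
  by apply: half => //; rewrite eq_sym.
have nz (v : K -> \bar int) z : normalized_valuation v -> (v z < 0)%E -> z != 0.
  by move=> hv; apply: contraTneq => ->; rewrite (nval0 hv).
have y0 := nz _ _ hw wy; have x0 := nz _ _ hw' w'x.
exists (x / y).
have [a wa] := nval_fin hw x0; have [b wb] := nval_fin hw y0.
have [a' wa'] := nval_fin hw' x0; have [b' wb'] := nval_fin hw' y0.
rewrite !(nvalM hw) !(nvalM hw') (nvalV hw wb) (nvalV hw' wb').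
rewrite wa wb wa' wb' !lte_fin !lee_fin in wx wy w'x w'y *.
by rewrite subr_gt0 subr_lt0 (lt_le_trans wy)// (lt_le_trans w'x).
Qed.

(** If x works for s but not for v, and y separates w from v, then x + y^N
    works for both once N is large. *)
Lemma nval_separate_seq w (s : seq (K -> \bar int)) : normalized_valuation w ->
  (forall v, v \in s -> normalized_valuation v /\ v != w) ->
  exists x, (0 < w x)%E /\ forall v, v \in s -> (v x < 0)%E.
Proof.
move=> hw; elim: s => [|v s IH] hs.
  have [x wx] : exists x, w x = 1%:E by case: hw.
  by exists x; rewrite wx.
have [|x [wx sx]] := IH; first by move=> u us; apply: hs; rewrite inE us orbT.
have [hv vw] := hs v (mem_head _ _).
have [vx|vx] := ltP (v x) 0%E.
  by exists x; split=> // u; rewrite inE => /orP[/eqP->//|]; exact: sx.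
have [|y [wy vy]] := nval_separate hw hv; first by rewrite eq_sym.
have y0 : y != 0 by apply: contraTneq vy => ->; rewrite (nval0 hv).
(* N exceeds the order of every pole of x at the valuations in s *)
pose N := (\max_(u <- s) `|fine (u x)|).+1.
exists (x + y ^+ N); split.
  apply: (nval_addlt hw) => //; rewrite /N exprS; apply: (nval_mulgt0l hw) => //.
  by apply: (nval_geX0 hw); exact: ltW.
move=> u; rewrite inE => /orP[/eqP->|us].
  have [b vb] := nval_fin hv y0; rewrite vb lte_fin in vy.
  have lt0 : (v (y ^+ N)%R < 0)%E by rewrite (nvalX hv _ vb) lte_fin pmulrn_llt0.
  by rewrite addrC (nval_dom hv)// (lt_le_trans lt0).
have [|hu _] := hs u; first by rewrite inE us orbT.
have ux := sx u us.
have x0 : x != 0 by apply: contraTneq ux => ->; rewrite (nval0 hu).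
have [a ua] := nval_fin hu x0; have [b ub] := nval_fin hu y0.
have aN : (`|a| < N)%N.
  by rewrite ltnS (leq_trans _ (leq_bigmax_seq _ us isT))// ua.
have [b0|b0] := leP 0 b.
  rewrite (nval_dom hu)// (nvalX hu _ ub) (lt_le_trans ux)// lee_fin.
  by rewrite pmulrn_lge0.
have lt : (u (y ^+ N)%R < u x)%E.
  rewrite (nvalX hu _ ub) ua lte_fin.
  rewrite ua lte_fin in ux.
  have b1 : b + 1 <= 0 by lia.
  have := mulr_le0_ge0 b1 (ltW (erefl : (0 : int) < N%:Z)).
  rewrite -mulr_natr natz mulrDl mul1r; move: (b * N%:Z) => c.
  by move: N aN => M; lia.
by rewrite addrC (nval_dom hu)// (lt_trans lt).
Qed.

Lemma weak_approximation w (s : seq (K -> \bar int)) : normalized_valuation w ->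
  (forall v, v \in s -> normalized_valuation v /\ v != w) ->
  exists x, w x = 0%E /\ forall v, v \in s -> (0 < v x)%E.
Proof.
move=> hw hs; have [x [wx sx]] := nval_separate_seq hw hs.
have w1x : w (1 + x) = 0%E by rewrite (nval_dom hw) (nval1 hw).
exists (1 + x)^-1; rewrite (nvalV hw w1x) oppr0; split=> // v vs.
have [hv _] := hs v vs; have vx := sx v vs.
have x0 : x != 0 by apply: contraTneq vx => ->; rewrite (nval0 hv).
have [a va] := nval_fin hv x0.
have v1x : v (1 + x) = a%:E by rewrite addrC (nval_dom hv) ?(nval1 hv).
by rewrite (nvalV hv v1x) lte_fin oppr_gt0 -lte_fin -va.
Qed.

End WeakApproximation.

Lemma infinite_uniq_seq (T : choiceType) (A : set T) n : infinite_set A ->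
  exists s : seq T, [/\ uniq s, (n <= size s)%N & forall x, x \in s -> A x].
Proof.
by move=> /(infinite_set_fset n)[B Bsub sB]; exists (finmap.enum_fset B).
Qed.

Section Finiteness.
Variables (k : closedFieldType) (K : fieldType) (kap : {rmorphism k -> K}) (t : K).
Local Notation at_t := (at_t kap t).
Hypothesis t_trans : injective at_t.
Variables (d : nat) (K_dep : dependent_over kap t d).

(** This names the place of k(t) below w without mentioning k(t); see
    [lies_aboveP]. *)
Definition centered_at (w : K -> \bar int) (v : place k) : Prop :=
  if v is Some a then residue kap w t a else (w t < 0)%E.

Definition ord_at (v : place k) (p : {poly k}) : int :=
  if v is Some a then (mup a p)%:Z else - (size p).-1%:Z.

Lemma center w : normalized_valuation w -> exists v, centered_at w v.
Proof.
move=> hw; have [t0|] := ltP (w t) 0%E; first by exists None.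
by move=> /(center_finite hw K_dep)[a ta]; exists (Some a).
Qed.

Lemma center_uniq w v v' : normalized_valuation w ->
  centered_at w v -> centered_at w v' -> v = v'.
Proof.
move=> hw; case: v v' => [a|] [b|] //=.
- by move=> ha /(residue_uniq hw ha) ->.
- by move=> /(residue_ge0 hw) h1 h2; move: h1; rewrite leNgt h2.
- by move=> h2 /(residue_ge0 hw) h1; move: h1; rewrite leNgt h2.
Qed.

Lemma nval_centered w v : normalized_valuation w -> centered_at w v ->
  exists2 e : nat, (0 < e)%N & forall p, p != 0 -> w (at_t p) = (e%:Z * ord_at v p)%:E.
Proof.
move=> hw; case: v => [a|] /= wv.
  have [e we] := nval_fin hw (t_neq_const t_trans a).
  have := wv; rewrite /residue we; case: e we => [[|e]|] // we _.
  exists e.+1 => // p p0; rewrite (nval_finite t_trans hw wv p0) (nvalX hw _ we).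
  by rewrite -mulr_natr natz.
have [e we] := nval_fin hw (t_neq0 t_trans).
have := wv; rewrite we; case: e we => [|e] // we _.
exists e.+1 => // p p0; rewrite (nval_infty t_trans hw wv p0) (nvalX hw _ we).
by rewrite NegzE mulNrn mulrN -mulr_natr natz.
Qed.

(** For d + 1 valuations with the same center, weak approximation would give
    d + 1 elements x i independent over k[t]: in a relation between them, the
    term whose coefficient has least order at v dominates for its own valuation. *)
Lemma finite_centered v :
  finite_set [set w : K -> \bar int | normalized_valuation w /\ centered_at w v].
Proof.
apply: contrapT => /(infinite_uniq_seq d.+1)[B [Buniq sB Bsub]].
pose W (i : 'I_d.+1) := nth (fun=> +oo%E) B i.
have iB (i : 'I_d.+1) : (i < size B)%N by exact: leq_trans sB.
have WB i : W i \in B by rewrite /W mem_nth.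
have W_inj i j : W i = W j -> i = j.
  by move=> /eqP; rewrite nth_uniq// => /eqP/val_inj.
have hW i : normalized_valuation (W i) by have [] := Bsub _ (WB i).
have cW i : centered_at (W i) v by have [] := Bsub _ (WB i).
have [x xP] : exists x : 'I_d.+1 -> K, forall i,
    W i (x i) = 0%E /\ forall j, j != i -> (0 < W j (x i))%E.
  have [|x h] := @choice _ _ (fun i x =>
    W i x = 0%E /\ forall j, j != i -> (0 < W j x)%E); last by exists x.
  move=> i; have [|x [h1 h2]] := @weak_approximation _ (W i)
      [seq W j | j <- enum 'I_d.+1 & j != i] (hW i).
    move=> u /mapP[j]; rewrite mem_filter => /andP[ji _] ->; split=> //.
    by apply: contra ji => /eqP/W_inj ->.
  exists x; split=> // j ji; apply: h2; apply/mapP; exists j => //.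
  by rewrite mem_filter ji mem_enum.
have [p [[i1 pi1]]] := K_dep x.
have [i pi imin] := @Order.TotalTheory.arg_minP _ _ _ i1
  (fun i => p i != 0) (fun i => ord_at v (p i)) pi1.
rewrite (bigD1 i)//= => /eqP; rewrite addr_eq0 => /eqP E.
have [e e0 we] := nval_centered (hW i) (cW i).
have : (W i (at_t (p i) * x i)%R < W i (- (\sum_(j < d.+1 | j != i) at_t (p j) * x j))%R)%E.
  rewrite (nvalN (hW i)) (nvalM (hW i)) (xP i).1 adde0 we//.
  apply: (nval_sumlt (hW i)) => j ji.
  have [pj0|pj0] := eqVneq (p j) 0.
    by rewrite pj0 rmorph0 mul0r (nval0 (hW i)) ltey.
  rewrite (nvalM (hW i)) we//; have := (xP j).2 i; rewrite eq_sym => /(_ ji).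
  case: (W i (x j)) => [m| |] //; last by move=> _; rewrite addey// ltey.
  rewrite -EFinD !lte_fin => m0; rewrite -[ltLHS]addr0 ler_ltD//.
  by rewrite ler_wpM2l// imin.
by rewrite -E ltxx.
Qed.

(** At a finite center of w, a pole of x forces the top coefficient of any
    algebraic relation for x over k[t] to vanish. *)
Lemma pole_center x : exists s : seq (place k), forall w v,
  normalized_valuation w -> (w x < 0)%E -> centered_at w v -> v \in s.
Proof.
have [p [[i1 pi1]]] := K_dep (fun i => x ^+ i).
have [i pi imax] := @arg_maxnP _ i1 (fun i => p i != 0) (fun i : 'I_d.+1 => i : nat) pi1.
move=> sum0; have [rs pE] := closed_field_poly_normal (p i).
exists (None :: [seq Some a | a <- rs]) => w [a|] hw wx wv; last by rewrite mem_head.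
rewrite inE /= mem_map; last by move=> b c [].
have x0 : x != 0 by apply: contraTneq wx => ->; rewrite (nval0 hw).
have [m wm] := nval_fin hw x0; rewrite wm lte_fin in wx.
have wp j : (0 <= w (at_t (p j)))%E.
  by apply: residue_ge0 (residue_at_t hw (p j) wv).
have root_pi : root (p i) a.
  apply: contrapT => nr.
  have wpi : w (at_t (p i)) = 0%E.
    by apply: (residue_neq0 hw (residue_at_t hw (p i) wv)); apply/negP.
  move: sum0; rewrite (bigD1 i)//= => /eqP; rewrite addr_eq0 => /eqP E.
  have : (w (at_t (p i) * x ^+ i)%R < w (- (\sum_(j < d.+1 | j != i) at_t (p j) * x ^+ j))%R)%E.
    rewrite (nvalN hw) (nvalM hw) wpi add0e (nvalX hw _ wm).
    apply: (nval_sumlt hw) => j ji.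
    have [pj0|pj0] := eqVneq (p j) 0.
      by rewrite pj0 rmorph0 mul0r (nval0 hw) ltey.
    have ji' : (j < i)%N.
      by rewrite ltn_neqAle; apply/andP; split=> //; exact: imax.
    rewrite (nvalM hw) (nvalX hw _ wm).
    have ml : m *+ i < m *+ j by rewrite ltr_nMn2l.
    have le : ((m *+ j)%:E <= w (at_t (p j)) + (m *+ j)%:E)%E by rewrite -[leLHS]add0e leeD2r.
    by apply: lt_le_trans le; rewrite lte_fin.
  by rewrite -E ltxx.
rewrite pE rootZ ?lead_coef_eq0// root_prod_XsubC in root_pi.
exact: root_pi.
Qed.

Lemma finite_poles x : finite_set [set w : K -> \bar int | normalized_valuation w /\ (w x < 0)%E].
Proof.
have [s sP] := pole_center x.
apply: (@sub_finite_set _ _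
  (\bigcup_(v in [set` s]) [set w : K -> \bar int | normalized_valuation w /\ centered_at w v])).
  move=> w [hw wx]; have [v wv] := center hw.
  by exists v => //; exact: sP wx wv.
apply: bigcup_finite; first exact: finite_seq.
by move=> v _; exact: finite_centered.
Qed.

End Finiteness.

(** * Riemann's inequality and the degree of t *)

Lemma closed_field_uniq_seq (k : closedFieldType) n : exists2 s : seq k, uniq s & size s = n.
Proof.
elim: n => [|n [s us ss]]; first by exists [::].
have /closed_nonrootP[x] : \prod_(a <- s) ('X - a%:P) != 0 :> {poly k}.
  by rewrite monic_neq0// monic_prod_XsubC.
by rewrite root_prod_XsubC => xs; exists (x :: s); rewrite /= ?xs ?ss.
Qed.

Lemma exists_const_nonroot (k : closedFieldType) (K : fieldType) (kap : {rmorphism k -> K})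
  (p : {poly K}) : p != 0 -> exists c, p.[kap c] != 0.
Proof.
move=> p0; have [s us ss] := closed_field_uniq_seq k (size p).
apply: contrapT => no.
have all_r : all (root p) (map kap s).
  apply/allP => _ /mapP[c _ ->].
  by apply/negPn/negP => nr; apply: no; exists c.
have us' : uniq (map kap s) by rewrite map_inj_uniq//; exact: fmorph_inj.
by have := max_poly_roots p0 all_r us'; rewrite size_map ss ltnn.
Qed.

Lemma shifted_powers_free (k : fieldType) n (a : 'I_n -> k) c :
  \sum_i a i *: ('X - c%:P) ^+ i = 0 -> forall i, a i = 0.
Proof.
move=> /(congr1 (fun p => p \Po ('X + c%:P))); rewrite raddf0 raddf_sum /=.
under eq_bigr do rewrite linearZ rmorphXn /= rmorphB /= comp_polyX comp_polyC addrK.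
move=> sum0 i; have := congr1 (fun p : {poly k} => p`_i) sum0.
rewrite coef0 coef_sum (bigD1 i)//= coefZ coefXn eqxx mulr1 big1 ?addr0// => j ji.
by rewrite coefZ coefXn eq_sym val_eqE (negPf ji) mulr0.
Qed.

Section Riemann.
Variables (k : closedFieldType) (K : fieldType) (kap : {rmorphism k -> K}) (t : K).
Local Notation at_t := (at_t kap t).
Hypothesis t_trans : injective at_t.
Variables (d : nat) (K_dep : dependent_over kap t d).

(** The Riemann-Roch space L(D) of the effective divisor D. *)
Definition in_space (D : (K -> \bar int) -> nat) (x : K) :=
  forall w, normalized_valuation w -> ((- (D w)%:Z)%:E <= w x)%E.

Lemma in_space0_const x : in_space (fun=> 0%N) x -> exists c, x = kap c.
Proof.
move=> h; apply: contrapT => no.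
have [|w hw wx] := exists_pole t_trans K_dep (z := x).
  by move=> c; apply/eqP => E; apply: no; exists c.
by have := h w hw; rewrite oppr0 leNgt wx.
Qed.

(** Riemann's bound dim L(D) <= deg D + 1, by removing one point of D at a time.
    The residue field is k, so an element z j that attains the bound at that
    point can be used to move all the others into the smaller space; at the end
    L(0) = k, because nonconstant elements have poles. *)
Lemma riemann (s : seq (K -> \bar int)) (D : (K -> \bar int) -> nat) :
  (forall w, w \in s -> normalized_valuation w) ->
  (forall w, normalized_valuation w -> w \notin s -> D w = 0%N) ->
  forall n (z : 'I_n -> K), (forall i, in_space D (z i)) ->
  (\sum_(w <- undup s) D w + 1 < n)%N ->
  exists c : 'I_n -> k, (exists i, c i != 0) /\ \sum_i kap (c i) * z i = 0.
Proof.
move=> hs; have [m] := ubnP (\sum_(w <- undup s) D w)%N.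
elim: m D => // m IH D mD Ds n z zD nD.
have [/eqP D0|] := eqVneq (\sum_(w <- undup s) D w)%N 0%N.
  have {}zD i : exists c, z i = kap c.
    apply: in_space0_const => w hw; have := zD i w hw.
    have [ws|ws] := boolP (w \in s); last by rewrite Ds.
    move: D0; rewrite sum_nat_seq_eq0 => /allP /(_ w).
    by rewrite mem_undup ws => /(_ isT)/eqP ->.
  case: n => [|[|n]] // in z zD nD *; first by rewrite addn1 in nD.
  have [a az] := zD ord0; have [b bz] := zD (lift ord0 ord0).
  have [a0|a0] := eqVneq a 0.
    exists (fun i => (i == ord0)%:R); split; first by exists ord0; rewrite eqxx oner_eq0.
    rewrite big_ord_recl big1 ?eqxx ?az ?a0 ?rmorph0 ?mulr0 ?addr0// => i _.
    by rewrite rmorph0 mul0r.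
  exists (fun i => if i == ord0 then - b else if i == lift ord0 ord0 then a else 0); split.
    by exists (lift ord0 ord0).
  rewrite big_ord_recl big_ord_recl big1 /=; last by move=> i _; rewrite rmorph0 mul0r.
  by rewrite az bz addr0 -!rmorphM mulNr -rmorphD mulrC addNr rmorph0.
rewrite sum_nat_seq_neq0 => /hasP[w0]; rewrite mem_undup => w0s /= Dw0.
have hw0 := hs _ w0s.
(* w0 is the point removed from D *)
pose D' w := if w == w0 then (D w).-1 else D w.
have sumD : (\sum_(w <- undup s) D w = (\sum_(w <- undup s) D' w).+1)%N.
  rewrite (bigD1_seq w0) ?mem_undup ?undup_uniq//=.
  rewrite [in RHS](bigD1_seq w0) ?mem_undup ?undup_uniq//=.
  rewrite /D' eqxx -addSn prednK ?lt0n//; congr (_ + _)%N.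
  by apply: eq_bigr => w /negPf ->.
have D's w : normalized_valuation w -> w \notin s -> D' w = 0%N.
  by move=> hw ws; rewrite /D' Ds//; case: eqP.
have mD' : (\sum_(w <- undup s) D' w < m)%N by rewrite -ltnS -sumD.
have toD' x : in_space D x -> ((- (D' w0)%:Z)%:E <= w0 x)%E -> in_space D' x.
  rewrite {1}/D' eqxx => xD xw0 w hw.
  by have := xD w hw; rewrite /D'; case: eqP => // ->.
have [all|] := pselect (forall i, in_space D' (z i)).
  by apply: (IH D') => //; rewrite (leq_trans _ nD)// sumD ltnS leq_add2r.
move=> /existsNP[j zj].
have wzj : w0 (z j) = (- (D w0)%:Z)%:E.
  apply/eqP; rewrite eq_le zD// andbT leNgt; apply/negP => lt; apply: zj.
  apply: toD' => //; move: lt; rewrite /D' eqxx.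
  case: (w0 (z j)) => [a| |] //; last by rewrite leey.
  by rewrite lte_fin lee_fin; case: (D w0) Dw0 => // e _; lia.
have zj0 : z j != 0.
  by apply/eqP => E; move: wzj; rewrite E (nval0 hw0).
have res i : exists a, residue kap w0 (z i / z j) a.
  apply: (residue_exists t_trans hw0 K_dep).
  rewrite (nvalM hw0) (nvalV hw0 wzj) opprK; have := zD i _ hw0.
  by case: (w0 (z i)) => [a| |] //; rewrite -EFinD !lee_fin; lia.
have [a aP] := @choice _ _ (fun i a => residue kap w0 (z i / z j) a) res.
case: n => [|n] in z zD nD j zj wzj zj0 res a aP *; first by have := ltn_ord j.
pose z' i := z (lift j i) - kap (a (lift j i)) * z j.
have z_D' i : in_space D' (z' i).
  apply: toD'.
    move=> w hw; rewrite /z'; apply: (nval_addl hw); first exact: zD.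
    rewrite (nvalN hw) -[(- _)%R]add0r; apply: (nval_geM hw); last exact: zD.
    exact: nval_const_ge0.
  have -> : z' i = (z (lift j i) / z j - kap (a (lift j i))) * z j.
    by rewrite mulrBl divfK.
  have := aP (lift j i); rewrite /residue (nvalM hw0) wzj /D' eqxx.
  case: (w0 _) => [e| |] //; last by rewrite addye// leey.
  by rewrite -EFinD lte_fin lee_fin; case: (D w0) Dw0 => // l _; lia.
have [|c [[i0 ci0] cz]] := IH D' mD' D's n z' z_D'.
  by rewrite -ltnS (leq_trans _ nD)// sumD.
pose c' i := if unlift j i is Some l then c l else - \sum_l c l * a (lift j l).
exists c'; split; first by exists (lift j i0); rewrite /c' liftK.
rewrite (bigD1_ord j)//= {1}/c' unlift_none.
under eq_bigr do rewrite /c' liftK.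
rewrite rmorphN rmorph_sum mulNr mulr_suml addrC -sumrB -[RHS]cz.
by apply: eq_bigr => i _; rewrite /z' mulrBr rmorphM mulrA.
Qed.

Lemma riemann_fin (s : seq (K -> \bar int)) (D : (K -> \bar int) -> nat)
  (I : finType) (z : I -> K) :
  (forall w, w \in s -> normalized_valuation w) ->
  (forall w, normalized_valuation w -> w \notin s -> D w = 0%N) ->
  (forall i, in_space D (z i)) ->
  (forall c : I -> k, \sum_i kap (c i) * z i = 0 -> forall i, c i = 0) ->
  (#|I| <= \sum_(w <- undup s) D w + 1)%N.
Proof.
move=> hs Ds zD free; rewrite leqNgt; apply/negP => lt.
have [c [[i ci] cz]] := riemann hs Ds (fun i : 'I_#|I| => zD (enum_val i)) lt.
move/eqP: ci; apply; rewrite -[i]enum_valK.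
apply: (free (fun x => c (enum_rank x))); rewrite -[RHS]cz.
rewrite (reindex (@enum_val I I)) /=; last first.
  by exists enum_rank => x _; rewrite ?enum_valK ?enum_rankK.
by apply: eq_bigr => l _; rewrite enum_valK.
Qed.

Variables (b : 'I_d -> K) (b_free : free_over kap t b).

(** The relation makes t - c the quotient of two elements z and q of L(Y), for
    a suitable constant c. The products z^i q^(N-i) b_l with i <= N and l < d
    are independent over k and lie in L(N Y + B), where B bounds the poles of
    the b_l. By Riemann's bound (N + 1) d <= N deg Y + deg B + 1 for all N. *)
Lemma degree_le_poles (r : nat) (y : 'I_r -> K) (s : seq (K -> \bar int))
    (Y : (K -> \bar int) -> nat) :
  \sum_(j < r) t ^+ j * y j = 0 -> (exists j, y j != 0) ->
  (forall w, w \in s -> normalized_valuation w) ->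
  (forall w, normalized_valuation w -> w \notin s -> Y w = 0%N) ->
  (forall w, normalized_valuation w -> w \notin s -> forall l, (0 <= w (b l))%E) ->
  (forall j, in_space Y (y j)) ->
  (d <= \sum_(w <- undup s) Y w)%N.
Proof.
move=> ty0 [j0 yj0] hs Ys bs yY.
pose p := \poly_(j < r) y (insubd j0 j).
have p0 : p != 0.
  apply/eqP => /(congr1 (fun p : {poly K} => p`_j0)); rewrite coef_poly ltn_ord coef0.
  by rewrite valKd; apply/eqP.
have [c] := exists_const_nonroot kap p0.
rewrite horner_poly; set z := (\sum_(i < r) _) => z0.
have zE : z = \sum_(j < r) y j * kap c ^+ j.
  by rewrite /z; apply: eq_bigr => j _; rewrite valKd.
have tc0 : t - kap c != 0 by exact: t_neq_const.
pose q := z / (t - kap c).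
have q0 : q != 0 by rewrite mulf_neq0 ?invr_eq0.
have zqt : z = q * (t - kap c) by rewrite divfK.
have zY : in_space Y z.
  move=> w hw; rewrite zE; apply: (nval_sum hw) => j _.
  rewrite -[(- _)%R]addr0; apply: (nval_geM hw); first exact: yY.
  by apply: (nval_geX0 hw); exact: nval_const_ge0.
have qY : in_space Y q.
  (* at infinity t - c has a pole, so q has no more poles than z; elsewhere
     q is a combination of the y_j with coefficients in k[t] *)
  move=> w hw; have [t0|t0] := leP 0%E (w t); last first.
    have wtc : w (t - kap c) = w t.
      rewrite (nval_dom hw)// (nvalN hw) (lt_le_trans t0)//; exact: nval_const_ge0.
    have [e we] := nval_fin hw tc0.
    rewrite /q (nvalM hw) (nvalV hw we); have := zY w hw.
    move: t0; rewrite -wtc we lte_fin; case: (w z) => [a| |] //.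
    by rewrite -EFinD !lee_fin; lia.
  have -> : q = - \sum_(j < r) y j * \sum_(l < j) t ^+ (j.-1 - l) * kap c ^+ l.
    have zE' : z = - (\sum_(j < r) t ^+ j * y j - z) by rewrite ty0 sub0r opprK.
    apply: (mulIf tc0); rewrite -zqt zE' zE mulNr mulr_suml -sumrB.
    congr (- _); apply: eq_bigr => j _.
    by rewrite (mulrC _ (y j)) -mulrBr subrXX -mulrA [in RHS](mulrC (\sum_(_ < _) _)).
  rewrite (nvalN hw); apply: (nval_sum hw) => j _.
  rewrite -[(- _)%R]addr0; apply: (nval_geM hw); first exact: yY.
  apply: (nval_sum hw) => l _; rewrite -[0%:E]/((0 + 0)%:E).
  apply: (nval_geM hw); apply: (nval_geX0 hw) => //; exact: nval_const_ge0.
clearbody q z.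
pose B w := \max_(l < d) (if (0 <= w (b l))%E then 0 else `|fine (w (b l))|)%N.
have Bs w : normalized_valuation w -> w \notin s -> B w = 0%N.
  by move=> hw ws; rewrite /B big1// => l _; rewrite bs.
have bB l : in_space B (b l).
  move=> w hw; apply: (@le_trans _ _
      (- (if (0 <= w (b l))%E then 0 else `|fine (w (b l))|)%N%:Z)%:E).
    rewrite lee_fin lerN2 lez_nat.
    exact: (@leq_bigmax_cond _ _ (fun l => if (0 <= w (b l))%E then 0 else `|fine (w (b l))|)%N).
  case: ifPn => [h|]; first by rewrite oppr0.
  rewrite -ltNge => h; have bl0 : b l != 0.
    by apply: contraTneq h => ->; rewrite (nval0 hw).
  by have [e we] := nval_fin hw bl0; rewrite we lte_fin /= in h *; rewrite lee_fin; lia.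
have main N : (N.+1 * d <= N * \sum_(w <- undup s) Y w + \sum_(w <- undup s) B w + 1)%N.
  pose D w := (N * Y w + B w)%N.
  pose e (il : 'I_N.+1 * 'I_d) := z ^+ il.1 * q ^+ (N - il.1) * b il.2.
  have := @riemann_fin s D _ e hs.
  rewrite card_prod !card_ord /D big_split -big_distrr /=; apply.
  - by move=> w hw ws; rewrite Ys// Bs// muln0.
  - move=> [i l] w hw; rewrite /e /= PoszD opprD.
    apply: (nval_geM hw); last exact: bB.
    have pow x n : in_space Y x -> ((- (n * Y w)%N%:Z)%:E <= w (x ^+ n)%R)%E.
      move=> /(_ w hw) h; elim: n => [|n IH]; first by rewrite expr0 (nval1 hw) mul0n oppr0.
      by rewrite exprS mulSn PoszD opprD; exact: nval_geM.
    have -> : (N * Y w = i * Y w + (N - i) * Y w)%N by rewrite -mulnDl subnKC// -ltnS.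
    by rewrite PoszD opprD; apply: (nval_geM hw); exact: pow.
  move=> a suma [i l].
  pose P l := \sum_(i < N.+1) a (i, l) *: ('X - c%:P) ^+ i.
  suff P0 m : P m = 0 by exact: (shifted_powers_free (P0 l)).
  move: m; apply: b_free; apply: (mulfI (expf_neq0 N q0)); rewrite mulr0 -[RHS]suma.
  rewrite mulr_sumr; under [LHS]eq_bigr => m _.
    rewrite /P rmorph_sum mulr_suml mulr_sumr; over.
  rewrite exchange_big pair_big /=; apply: eq_bigr => -[u v] _ /=.
  rewrite /e /= -mul_polyC rmorphM rmorphXn /= at_tC at_tXsubC zqt exprMn.
  have -> : q ^+ N = q ^+ u * q ^+ (N - u) by rewrite -exprD subnKC// -ltnS.
  ring.
set H := (\sum_(w <- _) _)%N in main *; set G := (\sum_(w <- _) _)%N in main.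
(* the slopes in N compare as claimed; N = deg B + 1 is large enough *)
have := main G.+1; rewrite -/H -/G => h; rewrite leqNgt; apply/negP => lt.
have : (G.+2 * H.+1 <= G.+2 * d)%N by rewrite leq_mul2l lt orbT.
by nia.
Qed.

End Riemann.

(** * Specialization to constant points *)

Section Specialization.
Variables (k : closedFieldType) (K : fieldType) (kap : {rmorphism k -> K}) (t : K).
Local Notation at_t := (at_t kap t).
Hypothesis t_trans : injective at_t.
Variables (d : nat) (K_dep : dependent_over kap t d).

Lemma pole_support (I : finType) (x : I -> K) : exists s : seq (K -> \bar int),
  (forall w, w \in s -> normalized_valuation w) /\
  (forall w, normalized_valuation w -> w \notin s -> forall i, (0 <= w (x i))%E).
Proof.
have : finite_set (\bigcup_(i in [set: I])
    [set w : K -> \bar int | normalized_valuation w /\ (w (x i) < 0)%E]).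
  apply: bigcup_finite; first exact: finite_finset.
  by move=> i _; exact: (finite_poles t_trans K_dep).
move=> /finite_seqP[s sE]; exists s; split.
  move=> w ws; have : [set` s] w by [].
  by rewrite -sE => -[i _ []].
move=> w hw ws i; rewrite leNgt; apply/negP => wx; move/negP: ws; apply.
suff : [set` s] w by [].
by rewrite -sE; exists i.
Qed.

(** The poles of the x i are finitely many, whereas there is a valuation centered
    at each of the infinitely many elements of k. *)
Lemma exists_good_valuation (I : finType) (x : I -> K) :
  exists2 w, normalized_valuation w & forall i, (0 <= w (x i))%E.
Proof.
have [s [_ sP]] := pole_support x.
have [r ur sr] := closed_field_uniq_seq k (size s).+1.
have [W WP] := @choice _ _ (fun a (w : K -> \bar int) =>
    normalized_valuation w /\ residue kap w t a) (fun a =>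
    let: ex_intro2 w hw ra := exists_above t_trans K_dep a in ex_intro _ w (conj hw ra)).
apply: contrapT => no.
suff : (size (map W r) <= size s)%N by rewrite size_map sr ltnn.
apply: uniq_leq_size.
  rewrite map_inj_uniq// => a b Wab; have [hw ra] := WP a.
  by have [_ rb] := WP b; apply: (residue_uniq hw ra); rewrite Wab.
move=> w /mapP[a _ ->]; apply/negPn/negP => Ws; apply: no.
by have [hw _] := WP a; exists (W a) => //; exact: sP.
Qed.

Lemma residue_meval w n (x : 'I_n -> K) (c : 'I_n -> k) (g : mpoly.mpoly n k) :
  normalized_valuation w -> (forall i, residue kap w (x i) (c i)) ->
  residue kap w (mpoly.mmap kap x g) (mpoly.meval c g).
Proof.
move=> hw xc; rewrite /mpoly.meval /mpoly.mmap.
apply: (big_rec2 (fun x c => residue kap w x c)).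
  by rewrite -(rmorph0 kap) residue_const.
move=> m a b _ ab; apply: (residueD hw) => //.
apply: (residueM hw); first exact: residue_const.
by apply: (residue_prod hw) => i; exact: residueX.
Qed.

(** Reduction modulo a valuation at which neither the coordinates of x nor the
    inverse of q(x) have a pole is a ring morphism from k[x, 1/q(x)] to k. *)
Lemma specialization n (x : 'I_n -> K) (q : mpoly.mpoly n k) :
  mpoly.mmap kap x q != 0 ->
  exists2 c : 'I_n -> k, mpoly.meval c q != 0 &
    forall g, mpoly.mmap kap x g = 0 -> mpoly.meval c g = 0.
Proof.
move=> qx; pose X (i : option 'I_n) := if i is Some i then x i else (mpoly.mmap kap x q)^-1.
have [w hw wX] := exists_good_valuation X.
have [c cx] : exists c : 'I_n -> k, forall i, residue kap w (x i) (c i).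
  have [|c h] := @choice _ _ (fun i c => residue kap w (x i) c); last by exists c.
  by move=> i; apply: (residue_exists t_trans hw K_dep); exact: (wX (Some i)).
exists c.
  apply/eqP => qc; have := residue_meval q hw cx; rewrite qc (residue0 kap) => q0.
  have [m wm] := nval_fin hw qx.
  have := wX None; rewrite /X (nvalV hw wm); move: q0; rewrite wm lte_fin lee_fin.
  by rewrite oppr_ge0 => h1 h2; move: (lt_le_trans h1 h2); rewrite ltxx.
move=> g gx; have := residue_meval g hw cx; rewrite gx => h.
by apply: (residue_uniq hw h); rewrite -{1}(rmorph0 kap) residue_const.
Qed.

End Specialization.

(** * Finite extensions of k(t) and their heights *)

Section Extensions.

Lemma exists_simple_extension (F L : fieldType) (iota : {rmorphism F -> L}) (z : L) :
  algebraicOver iota z -> exists (K : fieldExtType F) (j : {rmorphism K -> L}),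
    (forall a, j a%:A = iota a) /\ exists y, j y = z.
Proof.
move=> alg_z.
have ex : exists n : nat, `[< exists p : {poly F},
    [/\ p != 0, root (map_poly iota p) z & size p = n] >].
  by have [p p0 pz] := alg_z; exists (size p); apply/asboolP; exists p.
have [_ /asboolP[p [p0 pz <-]] pmin] := ex_minnP ex.
have irr : irreducible_poly p.
  apply/(subfx_irreducibleP pz p0) => q qz q0.
  by apply: pmin; apply/asboolP; exists q.
exists (SubFieldExtType pz irr), (@subfx_inj _ _ iota z p).
split=> [a|]; first exact: subfx_inj_base.
by exists (subfx_root iota z p); exact: subfx_inj_root.
Qed.

Lemma exists_extension (F L : fieldType) (iota : {rmorphism F -> L}) (zs : seq L) :
  (forall z, algebraicOver iota z) ->
  exists (K : fieldExtType F) (j : {rmorphism K -> L}),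
    (forall a, j a%:A = iota a) /\ forall z, z \in zs -> exists y, j y = z.
Proof.
elim: zs F iota => [|z zs IH] F iota alg.
  by have [K [j [jE _]]] := exists_simple_extension (alg 0); exists K, j.
have [K1 [j1 [j1E [y1 y1z]]]] := exists_simple_extension (alg z).
have [|K2 [j2 [j2E hj2]]] := IH K1 j1.
  move=> u; have [p p0 pu] := alg u; exists (map_poly (in_alg K1) p).
    by rewrite map_poly_eq0.
  by rewrite -map_poly_comp (eq_map_poly (g := iota)).
pose j : {rmorphism baseFieldType K2 -> L} := j2.
exists (baseFieldType K2), j; split=> [a|u].
  by rewrite baseField_scaleE [LHS]j2E j1E.
rewrite inE => /orP[/eqP->|/hj2//].
by exists (y1%:A : K2); rewrite [LHS]j2E.
Qed.

End Extensions.

Section Fractions.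
Variable k : closedFieldType.

Lemma frac_numden (x : ratfun k) :
  x * FracField.tofrac \d_(repr x) = FracField.tofrac \n_(repr x).
Proof.
rewrite -{1}[x]reprK; unlock FracField.tofrac.
rewrite -[LHS]FracField.pi_mul; apply/eqP; rewrite FracField.equivf_def.
have d0 := denom_ratioP (repr x).
have d1 : \d_(repr x) * 1 != 0 by rewrite mulr1.
rewrite /FracField.equivf /FracField.mulf !numden_Ratio ?oner_neq0//.
by rewrite !mulr1 mulrC.
Qed.

Lemma frac_den_neq0 (x : ratfun k) : \d_(repr x) != 0.
Proof. exact: denom_ratioP. Qed.

Lemma common_denominator (I : finType) (x : I -> ratfun k) :
  exists2 e : {poly k}, e != 0 & forall i, exists a, FracField.tofrac e * x i = FracField.tofrac a.
Proof.
exists (\prod_i \d_(repr (x i))).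
  by apply/prodf_neq0 => i _; exact: frac_den_neq0.
move=> i; exists (\n_(repr (x i)) * \prod_(j | j != i) \d_(repr (x j))).
by rewrite (bigD1 i)//= !tofracM -(frac_numden (x i)) mulrC mulrA.
Qed.

Section Concrete.
Variable K : fieldExtType (ratfun k).

Definition const_in : k -> K := in_alg K \o (@FracField.tofrac {poly k}) \o polyC.
HB.instance Definition _ := GRing.RMorphism.copy const_in
  (in_alg K \o (@FracField.tofrac {poly k}) \o polyC).

Definition t_in : K := (FracField.tofrac 'X)%:A.

Lemma at_t_in p : at_t const_in t_in p = (FracField.tofrac p)%:A.
Proof.
pose f : {rmorphism {poly k} -> K} := in_alg K \o (@FracField.tofrac {poly k}).
rewrite at_t_sum -[p in RHS]coefK poly_def.
have -> : (FracField.tofrac (\sum_(i < size p) p`_i *: 'X^i))%:A =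
  f (\sum_(i < size p) p`_i *: 'X^i) by [].
rewrite rmorph_sum; apply: eq_bigr => i _.
by rewrite -mul_polyC rmorphM rmorphXn.
Qed.

Lemma t_in_trans : injective (at_t const_in t_in).
Proof.
move=> p q; rewrite !at_t_in => /(fmorph_inj (in_alg K)) /eqP.
by rewrite tofrac_eq => /eqP.
Qed.

Lemma dependent_in : dependent_over const_in t_in (\dim {:K}).
Proof.
move=> z; pose X := [tuple z i | i < (\dim {:K}).+1].
have nfree : ~~ free X.
  apply/negP => /eqP fX; have := dimvS (subvf <<X>>).
  by rewrite fX size_tuple ltnn.
have [c [[i ci] cX]] : exists c : 'I_(\dim {:K}).+1 -> ratfun k,
    (exists i, c i != 0) /\ \sum_i c i *: X`_i = 0.
  apply: contrapT => no; move/negP: nfree; apply; apply/freeP => c cX i.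
  by apply/eqP/negPn/negP => ci; apply: no; exists c; split=> //; exists i.
have [e e0 /choice[a aP]] := common_denominator c.
exists a; split.
  exists i; rewrite -tofrac_eq0 -aP; apply: mulf_neq0; last exact: ci.
  by rewrite tofrac_eq0; exact: e0.
transitivity ((FracField.tofrac e) *: \sum_i c i *: X`_i); last by rewrite cX scaler0.
rewrite scaler_sumr; apply: eq_bigr => j _.
by rewrite at_t_in -aP scalerA (nth_mktuple z 0 j) -scalerAl mul1r.
Qed.

Definition basis_in (i : 'I_(\dim {:K})) : K := (vbasis {:K})`_i.

Lemma basis_in_lin (c : 'I_(\dim {:K}) -> ratfun k) :
  \sum_i c i *: basis_in i = 0 -> forall i, c i = 0.
Proof. by apply/freeP; exact: (basis_free (vbasisP _)). Qed.

Lemma free_in : free_over const_in t_in basis_in.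
Proof.
move=> p psum i; apply/eqP; rewrite -tofrac_eq0; apply/eqP; move: i.
apply: basis_in_lin; rewrite -[RHS]psum; apply: eq_bigr => i _.
by rewrite at_t_in -scalerAl mul1r.
Qed.

Lemma ord_atM v (p q : {poly k}) : p != 0 -> q != 0 ->
  ord_at v (p * q) = ord_at v p + ord_at v q.
Proof.
move=> p0 q0; case: v => [a|] /=; first by rewrite mupM.
rewrite size_mul// -opprD -PoszD; congr (- Posz _).
have := size_poly_gt0 p; have := size_poly_gt0 q; rewrite p0 q0.
by move: (size p) (size q) => [|x] [|y] //= _ _; rewrite addnS.
Qed.

Lemma place_valE v (x : ratfun k) : x != 0 ->
  place_val v x = (ord_at v \n_(repr x) - ord_at v \d_(repr x))%:E.
Proof.
rewrite /place_val => /negPf ->; case: v => [a|] //=.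
by rewrite opprK addrC.
Qed.

Lemma num_neq0 (x : ratfun k) : x != 0 -> \n_(repr x) != 0.
Proof.
move=> x0; rewrite -tofrac_eq0 -frac_numden; apply: mulf_neq0; first exact: x0.
by rewrite tofrac_eq0; exact: frac_den_neq0.
Qed.

Lemma place_val_tofrac v (p : {poly k}) : p != 0 ->
  place_val v (FracField.tofrac p) = (ord_at v p)%:E.
Proof.
move=> p0; have p0' : FracField.tofrac p != 0 by rewrite tofrac_eq0.
rewrite place_valE//; set n := \n_ _; set d := \d_ _.
have : FracField.tofrac (p * d) = FracField.tofrac n by rewrite tofracM frac_numden.
move=> /eqP; rewrite tofrac_eq => /eqP <-.
by rewrite ord_atM ?frac_den_neq0// addrK.
Qed.

Lemma lies_aboveP (w : K -> \bar int) v : normalized_valuation w ->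
  lies_above w v <-> centered_at const_in t_in w v.
Proof.
move=> hw; split=> [[e e0 we]|wv].
  have we' p : p != 0 -> w (at_t const_in t_in p) = (e%:Z * ord_at v p)%:E.
    move=> p0; rewrite at_t_in we ?tofrac_eq0// place_val_tofrac//.
  case: v we we' => [a|] /= we we'.
    rewrite /residue -at_tXsubC we' ?polyXsubC_eq0//.
    by rewrite -['X - _]expr1 mup_XsubCX eqxx mulr1 lte_fin.
  by rewrite -(at_tX const_in t_in) we' ?polyX_eq0// size_polyX lte_fin mulrN1 oppr_lt0.
have [e e0 we] := nval_centered t_in_trans hw wv.
exists e => // x x0; rewrite place_valE//.
have d0 := frac_den_neq0 x; have n0 := num_neq0 x0.
have := congr1 (in_alg K) (frac_numden x); rewrite rmorphM /= -!at_t_in.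
move=> /(canRL (mulfK _)) ->; last by rewrite at_t_eq0//; exact: t_in_trans.
rewrite (nvalM hw) (nvalV hw (we _ d0)) (we _ n0) -!EFinD -EFinM.
by rewrite -mulrN -mulrDr.
Qed.

Lemma places_aboveE v : @places_above k K v =
  [set w : K -> \bar int | normalized_valuation w /\ centered_at const_in t_in w v].
Proof.
by apply/seteqP; split=> w [hw wv]; split=> //; apply/lies_aboveP.
Qed.

Lemma local_heightE (w : K -> \bar int) n (x : 'I_n -> K) : normalized_valuation w ->
  (local_height w x)%:E = \big[Order.max/0%E]_(i < n) (- w (x i))%E.
Proof.
move=> hw; rewrite /local_height fineK//.
have ge0 : (0 <= \big[Order.max/0%E]_(i < n) (- w (x i))%E)%E by exact: bigmax_ge_id.
rewrite fin_numE; apply/andP; split; first by case: (\big[_/_]_(i < n) _) ge0.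
apply: (big_ind (fun m => m != +oo%E)) => // [a b a0 b0|i _].
  by rewrite /Order.max; case: ifP.
by case: hw => _ /(_ (x i)) + _ _; case: (w (x i)).
Qed.

Lemma local_height_ge (w : K -> \bar int) n (x : 'I_n -> K) i :
  normalized_valuation w -> ((- local_height w x)%:E <= w (x i))%E.
Proof.
move=> hw; have : ((- w (x i)) <= (local_height w x)%:E)%E.
  by rewrite local_heightE//; exact: (le_bigmax _ (fun i => - w (x i))%E).
by rewrite EFinN leeNl.
Qed.

Lemma local_height_ge0 (w : K -> \bar int) n (x : 'I_n -> K) :
  normalized_valuation w -> 0 <= local_height w x.
Proof. by move=> hw; rewrite -lee_fin local_heightE//; exact: bigmax_ge_id. Qed.

Lemma local_height_eq0 (w : K -> \bar int) n (x : 'I_n -> K) :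
  (forall i, (0 <= w (x i))%E) -> local_height w x = 0.
Proof.
move=> x0; rewrite /local_height (_ : \big[_/_]_(i < n) _ = 0%E)//.
apply/le_anti/andP; split; last exact: bigmax_ge_id.
by apply: bigmax_le => // i _; rewrite leeNl oppe0.
Qed.

(** Every valuation lies above exactly one place, so the double sum is a sum over
    the valuations, of which only those in s contribute. *)
Lemma height_inE (R : realType) n (x : 'I_n -> K) (s : seq (K -> \bar int)) :
  (forall w, w \in s -> normalized_valuation w) ->
  (forall w, normalized_valuation w -> w \notin s -> forall i, (0 <= w (x i))%E) ->
  height_in R x = (\dim {:K})%:R^-1 * \sum_(w <- undup s) (local_height w x)%:~R.
Proof.
move=> hs xs; rewrite /height_in; congr (_ * _).
pose f (w : K -> \bar int) : R := (local_height w x)%:~R.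
have [cen cenP] : exists cen : (K -> \bar int) -> place k, forall w,
    normalized_valuation w -> centered_at const_in t_in w (cen w).
  have [|cen h] := @choice _ _ (fun (w : K -> \bar int) v =>
    normalized_valuation w -> centered_at const_in t_in w v); last by exists cen.
  move=> w; have [hw|nw] := pselect (normalized_valuation w).
    by have [v wv] := center dependent_in hw; exists v.
  by exists None.
have inner (v : place k) : \sum_(w \in @places_above k K v) f w =
    \sum_(w <- undup s | cen w == v) f w.
  rewrite (fsbigE [seq w <- undup s | cen w == v]) ?filter_uniq ?undup_uniq//.
  - rewrite big_filter_cond; rewrite big_seq_cond [RHS]big_seq_cond.
    apply: eq_bigl => w; rewrite mem_undup.
    have [ws|//] := boolP (w \in s); have [wv|//] := eqVneq (cen w) v.
    have wp : @places_above k K v w.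
      by rewrite places_aboveE -wv; split; [exact: hs|apply: cenP; exact: hs].
    by rewrite /= (mem_set wp).
  - move=> w /=; rewrite mem_filter mem_undup places_aboveE => /andP[/eqP <- ws].
    by split; [exact: hs|apply: cenP; exact: hs].
  - move=> w; rewrite places_aboveE => -[hw wv]; rewrite mem_filter mem_undup.
    have -> : cen w == v by apply/eqP; exact: center_uniq hw (cenP w hw) wv.
    by move=> ws; rewrite /f local_height_eq0//; exact: xs.
rewrite (eq_fsbigr (fun v => \sum_(w <- undup s | cen w == v) f w)); last first.
  by move=> v _; exact: inner.
rewrite (fsbigE (undup (map cen (undup s)))) ?undup_uniq//; last first.
  move=> v _; rewrite mem_undup => vs; rewrite big_seq_cond big1// => w /andP[ws /eqP wv].
  by move/negP: vs; case; rewrite -wv map_f.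
rewrite (eq_bigl xpredT); last by move=> v; rewrite in_setT.
under eq_bigr do rewrite big_mkcond.
rewrite exchange_big /= big_seq [RHS]big_seq; apply: eq_bigr => w ws.
rewrite (bigD1_seq (cen w)) ?undup_uniq ?mem_undup ?map_f//= eqxx big1 ?addr0// => v.
by rewrite eq_sym => /negPf ->.
Qed.

End Concrete.
End Fractions.

(** * Noetherian rings and finite systems of equations *)

Definition ideal_like (A : comNzRingType) (J : A -> Prop) :=
  [/\ J 0, forall x y, J x -> J y -> J (x + y) & forall c x, J x -> J (c * x)].

(** The membership of a N in the ideal generated by its predecessors is expressed
    through all the ideals that contain them. *)
Definition noetherian (A : comNzRingType) := forall a : nat -> A,
  exists N, forall J, ideal_like J -> (forall i, (i < N)%N -> J (a i)) -> J (a N).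

Lemma noetherian_field (F : fieldType) : noetherian F.
Proof.
move=> a; have [a0|a0] := eqVneq (a 0%N) 0.
  by exists 0%N => J [J0 _ _] _; rewrite a0.
exists 1%N => J [_ _ JM] Ja; rewrite -(divfK a0 (a 1%N)).
by apply/JM/Ja.
Qed.

(** If a were a counterexample, the ideal I that it generates would not be finitely
    generated, so that one could choose q N in I of least degree outside the
    ideal generated by q 0, ..., q (N - 1). As soon as the leading coefficient of
    q N is a combination of the previous ones, subtracting the corresponding
    combination of the previous q i contradicts the choice of q N. *)
Lemma hilbert_basis (A : comNzRingType) : noetherian A -> noetherian {poly A}.
Proof.
move=> noethA a; apply: contrapT => bad.
pose span M x := forall J : {poly A} -> Prop, ideal_like J ->
  (forall i, (i < M)%N -> J (a i)) -> J x.
pose gen (r : seq {poly A}) x := forall J : {poly A} -> Prop, ideal_like J ->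
  (forall y, y \in r -> J y) -> J x.
pose I x := exists M, span M x.
have span_le M M' x : (M <= M')%N -> span M x -> span M' x.
  by move=> MM' Mx J Ji Ja; apply: Mx => // i iM; apply: Ja; exact: leq_trans MM'.
have I_ideal : ideal_like I.
  split=> [|x y [M Mx] [M' My]|c x [M Mx]].
  - by exists 0%N => J [].
  - exists (maxn M M') => J Ji Ja; have [_ JD _] := Ji; apply: JD.
      exact: span_le (leq_maxl _ _) Mx _ Ji Ja.
    exact: span_le (leq_maxr _ _) My _ Ji Ja.
  - by exists M => J Ji Ja; have [_ _ JM] := Ji; apply: JM; exact: Mx.
have gen_ideal r : ideal_like (gen r).
  split=> [J []//|x y gx gy J Ji Jr|c x gx J Ji Jr]; have [_ JD JM] := Ji.
    by apply: JD; [exact: gx|exact: gy].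
  by apply: JM; exact: gx.
have outside r : (forall y, y \in r -> I y) -> exists x, I x /\ ~ gen r x.
  move=> rI; have [M rM] : exists M, forall y, y \in r -> span M y.
    elim: r rI => [|y r IH] rI; first by exists 0%N.
    have [|M rM] := IH; first by move=> z zr; apply: rI; rewrite inE zr orbT.
    have [M' yM'] := rI y (mem_head _ _).
    exists (maxn M M') => z; rewrite inE => /orP[/eqP->|/rM].
      exact: span_le (leq_maxr _ _) yM'.
    exact: span_le (leq_maxl _ _).
  exists (a M); split; first by exists M.+1 => J _; exact.
  move=> gaM; apply: bad; exists M => J Ji Ja; apply: gaM => // y yr.
  exact: rM Ji Ja.
have minimal r : (forall y, y \in r -> I y) ->
    exists x, [/\ I x, ~ gen r x & forall y, I y -> ~ gen r y -> (size x <= size y)%N].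
  move=> /outside[x0 [Ix0 gx0]].
  have ex : exists m : nat, `[< exists x, [/\ I x, ~ gen r x & size x = m] >].
    by exists (size x0); apply/asboolP; exists x0.
  have [_ /asboolP[x [Ix gx <-]] xmin] := ex_minnP ex.
  by exists x; split=> // y Iy gy; apply: xmin; apply/asboolP; exists y.
have [G GP] := @choice _ _ (fun r x => (forall y, y \in r -> I y) ->
    [/\ I x, ~ gen r x & forall y, I y -> ~ gen r y -> (size x <= size y)%N])
  (fun r => match pselect (forall y, y \in r -> I y) with
    | left h => let: ex_intro x hx := minimal r h in ex_intro _ x (fun _ => hx)
    | right nh => ex_intro _ 0 (fun h => False_ind _ (nh h)) end).
pose l := fix l N := if N is N'.+1 then G (l N') :: l N' else [::].
have lI N : forall y, y \in l N -> I y.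
  elim: N => [|N IH] //= y; rewrite inE => /orP[/eqP->|]; last exact: IH.
  by have [] := GP _ IH.
pose q N := G (l N).
have ql i N : (i < N)%N -> q i \in l N.
  elim: N => // N IH; rewrite ltnS leq_eqVlt => /orP[/eqP->|/IH] /=; first exact: mem_head.
  by rewrite inE orbC => ->.
have gen_le i N x : (i <= N)%N -> gen (l i) x -> gen (l N) x.
  move=> iN gx J Ji Jl; apply: gx => // y yl; apply: Jl; elim: N iN => [|N IH].
    by rewrite leqn0 => /eqP i0; rewrite i0 in yl.
  rewrite leq_eqVlt => /orP[/eqP<-//|]; rewrite ltnS => /IH.
  by rewrite [l N.+1]/= inE orbC => ->.
have [N hN] := noethA (fun i => lead_coef (q i)).
have [Iq gq qmin] := GP _ (lI N); rewrite -/(q N) in Iq gq qmin.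
have [g0 gD gM] := gen_ideal (l N); have [_ ID IM] := I_ideal.
have q0 i : size (q i) = (size (q i)).-1.+1.
  rewrite prednK// size_poly_gt0; have [_ + _] := GP _ (lI i); apply: contra_notN.
  by rewrite -/(q i) => /eqP ->; have [] := gen_ideal (l i).
pose m := (size (q N)).-1.
have [|i iN|y [gy sy yE]] := hN (fun b => exists y,
    [/\ gen (l N) y, (size y <= m.+1)%N & y`_m = b]).
- split=> [|_ _ [x [gx sx <-]] [y [gy sy <-]]|c _ [x [gx sx <-]]].
  + by exists 0; rewrite size_poly0 coef0.
  + exists (x + y); rewrite coefD; split=> //; first exact: gD.
    by rewrite (leq_trans (size_polyD _ _))// geq_max sx sy.
  + exists (c%:P * x); rewrite coefCM; split=> //; first exact: gM.
    by rewrite mul_polyC (leq_trans (size_scale_leq _ _)).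
- have siN : ((size (q i)).-1 <= m)%N.
    rewrite -ltnS -q0 /m -q0; have [_ _ imin] := GP _ (lI i).
    by apply: imin => // /(gen_le _ _ _ (ltnW iN)).
  exists ('X^(m - (size (q i)).-1) * q i); split.
  + by apply: gM => J _; apply; exact: ql.
  + apply/leq_sizeP => j mj; rewrite coefXnM; case: ltnP => // le.
    rewrite nth_default//; have := q0 i; move: siN mj {le}; clearbody m.
    by move: (size (q i)) => e; lia.
  + by rewrite coefXnM ltnNge leq_subr /= subKn.
have Iy : I y by apply: gy => // z; exact: lI.
have lt : (size (q N - y)%R < size (q N))%N.
  rewrite [leqRHS]q0 ltnS; apply/leq_sizeP => j mj.
  rewrite coefB; move: mj; rewrite leq_eqVlt => /orP[/eqP<-|mj].
    by rewrite yE lead_coefE subrr.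
  by rewrite !nth_default ?subrr// (leq_trans _ mj)// q0.
apply: gq; rewrite -(subrK y (q N)); apply: gD => //; apply: contrapT => ng.
have Iz : I (q N - y) by rewrite -mulN1r; apply: ID => //; exact: IM.
by have := qmin _ Iz ng; rewrite leqNgt lt.
Qed.

(** Polynomial functions in n variables are a quotient of an n-fold iterated
    polynomial ring, presented here by its evaluation morphisms. *)
Lemma noetherian_functions (F : fieldType) n : exists (A : comNzRingType)
    (phi : (nat -> F) -> {rmorphism A -> F}),
  [/\ noetherian A, forall c, exists a, forall P, phi P a = c
    & forall i, (i < n)%N -> exists a, forall P, phi P a = P i].
Proof.
elim: n => [|n [A [phi [noethA const vars]]]].
  exists F, (fun=> idfun); split=> //; first exact: noetherian_field.
  by move=> c; exists c.
exists {poly A}, (fun P => horner_eval (P n) \o map_poly (phi P)).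
split=> [|c|i].
- exact: hilbert_basis.
- have [a ac] := const c; exists a%:P => P.
  by rewrite /= map_polyC /horner_eval hornerC; exact: ac.
- rewrite ltnS leq_eqVlt => /orP[/eqP->|/vars[a aP]].
    by exists 'X => P; rewrite /= map_polyX /horner_eval hornerX.
  by exists a%:P => P; rewrite /= map_polyC /horner_eval hornerC; exact: aP.
Qed.

(** Otherwise one could choose in S an infinite sequence of polynomials, none of
    which vanishes on the common zeros of its predecessors. *)
Lemma finite_equations (F : fieldType) n (S : set (mpoly.mpoly n F)) :
  exists s : seq (mpoly.mpoly n F), (forall p, p \in s -> S p) /\
    forall P, (forall p, p \in s -> mpoly.meval P p = 0) -> forall p, S p -> mpoly.meval P p = 0.
Proof.
have [A [phi [noethA const vars]]] := noetherian_functions F n.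
(* points with n coordinates, extended by zero to all indices *)
pose ext (P : 'I_n -> F) (i : nat) : F := if insub i is Some i then P i else 0.
have lift (p : mpoly.mpoly n F) : exists a, forall P, phi (ext P) a = mpoly.meval P p.
  have mon (m : mpoly.multinom n) : exists a, forall P : 'I_n -> F,
      phi (ext P) a = \prod_i P i ^+ m i.
    have [a aP] : exists a : 'I_n -> A, forall i P, phi (ext P) (a i) = P i.
      have [|a h] := @choice _ _ (fun (i : 'I_n) a => forall P, phi (ext P) a = P i).
        2: by exists a.
      move=> i; have [a aP] := vars i (ltn_ord i); exists a => P.
      by rewrite aP /ext valK.
    exists (\prod_i a i ^+ m i) => P; rewrite rmorph_prod; apply: eq_bigr => i _.
    by rewrite rmorphXn aP.
  have [u uP] := @choice _ _ _ mon; have [c cP] := @choice _ _ _ const.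
  exists (\sum_(m <- mpoly.msupp p) c (mpoly.mcoeff m p) * u m) => P.
  rewrite mpoly.mevalE rmorph_sum; apply: eq_bigr => m _.
  by rewrite rmorphM cP uP.
have [u uP] := @choice _ _ _ lift.
apply: contrapT => bad.
have next (s : seq (mpoly.mpoly n F)) : exists p, (forall p, p \in s -> S p) ->
    S p /\ exists P, (forall p, p \in s -> mpoly.meval P p = 0) /\ mpoly.meval P p <> 0.
  have [sS|nS] := pselect (forall p, p \in s -> S p); last by exists 0.
  apply: contrapT => no; apply: bad; exists s; split=> // P Ps p Sp.
  by apply: contrapT => pP; apply: no; exists p => _; split=> //; exists P.
have [G GP] := @choice _ _ _ next.
pose l := fix l N := if N is N'.+1 then G (l N') :: l N' else [::].
have lS N : forall p, p \in l N -> S p.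
  elim: N => [|N IH] //= y; rewrite inE => /orP[/eqP->|]; last exact: IH.
  by have [] := GP _ IH.
have ql i N : (i < N)%N -> G (l i) \in l N.
  elim: N => // N IH; rewrite ltnS leq_eqVlt => /orP[/eqP->|/IH] /=; first exact: mem_head.
  by rewrite inE orbC => ->.
have [N hN] := noethA (fun i => u (G (l i))).
have [_ [P [Pl PG]]] := GP _ (lS N).
apply: PG; rewrite -uP; apply: (hN (fun a => phi (ext P) a = 0)).
  split=> [|x y x0 y0|c x x0]; first exact: rmorph0.
    by rewrite rmorphD x0 y0 addr0.
  by rewrite rmorphM x0 mulr0.
by move=> i iN; rewrite uP; apply: Pl; exact: ql.
Qed.

(** * Norms of polynomials *)

Section Norm.
Variables (k L : closedFieldType) (iota : {rmorphism ratfun k -> L}).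
Hypothesis Lclosure : is_algebraic_closure iota.

Definition const_out : k -> L := iota \o (@FracField.tofrac {poly k}) \o polyC.
HB.instance Definition _ := GRing.RMorphism.copy const_out
  (iota \o (@FracField.tofrac {poly k}) \o polyC).

Definition t_out : L := iota (FracField.tofrac 'X).

Lemma at_t_out p : at_t const_out t_out p = iota (FracField.tofrac p).
Proof.
pose f : {rmorphism {poly k} -> L} := iota \o (@FracField.tofrac {poly k}).
rewrite at_t_sum -[p in RHS]coefK poly_def.
have -> : iota (FracField.tofrac (\sum_(i < size p) p`_i *: 'X^i)) =
  f (\sum_(i < size p) p`_i *: 'X^i) by [].
rewrite rmorph_sum; apply: eq_bigr => i _.
by rewrite -mul_polyC rmorphM rmorphXn.
Qed.

Variable n : nat.
Local Notation MP := (mpoly.mpoly n).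

Definition eval_out (P : 'I_n -> L) : {poly MP k} -> L :=
  horner_eval t_out \o map_poly (mpoly.mmap const_out P).
HB.instance Definition _ P := GRing.RMorphism.copy (eval_out P)
  (horner_eval t_out \o map_poly (mpoly.mmap const_out P)).

Definition eval_const (c : 'I_n -> k) : {poly MP k} -> {poly k} :=
  map_poly (mpoly.meval c).
HB.instance Definition _ c := GRing.RMorphism.copy (eval_const c)
  (map_poly (mpoly.meval c)).

Lemma eval_out_mono P (a : {poly k}) m :
  eval_out P (map_poly (@mpoly.mpolyC n k) a * (mpoly.mpolyX k m)%:P) =
  iota (FracField.tofrac a) * \prod_i P i ^+ m i.
Proof.
rewrite rmorphM; congr (_ * _).
  rewrite -at_t_out at_tE.
  change ((map_poly (mpoly.mmap const_out P) (map_poly (@mpoly.mpolyC n k) a)).[t_out] = 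
    (map_poly const_out a).[t_out]).
  congr (_.[_]); apply/polyP => i; rewrite !coef_map; exact: mpoly.mmapC.
change ((map_poly (mpoly.mmap const_out P) (mpoly.mpolyX k m)%:P).[t_out] = \prod_i P i ^+ m i).
by rewrite map_polyC hornerC /= mpoly.mmapX.
Qed.

Lemma eval_const_mono c (a : {poly k}) m :
  eval_const c (map_poly (@mpoly.mpolyC n k) a * (mpoly.mpolyX k m)%:P) =
  a * (\prod_i c i ^+ m i)%:P.
Proof.
rewrite rmorphM; congr (_ * _).
  by apply/polyP => i; rewrite !coef_map /=; exact: mpoly.mevalC.
change (map_poly (mpoly.meval c) (mpoly.mpolyX k m)%:P = (\prod_i c i ^+ m i)%:P).
by rewrite map_polyC /= mpoly.mevalX.
Qed.

(** G is the norm of e f, where e is a common denominator and the norm is taken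
    from a finite extension K of k(t) that contains the coefficients of f: it is
    the determinant of the matrix M of multiplication by e f in a basis b of K.
    At P the vector b is an eigenvector of M with eigenvalue e f(P), so M becomes
    singular when f(P) = 0. At a constant point c the matrix is that of
    multiplication by e f(c) on K, which is singular only if f(c) = 0. *)
Lemma norm_polynomial (f : MP L) : exists G : {poly MP k},
  (forall P, mpoly.meval P f = 0 -> eval_out P G = 0) /\
  (forall c, eval_const c G = 0 -> mpoly.meval (const_out \o c) f = 0).
Proof.
pose r := size (mpoly.msupp f).
pose mon (u : 'I_r) := tnth (in_tuple (mpoly.msupp f)) u.
have evalf P : mpoly.meval P f = \sum_(u < r) mpoly.mcoeff (mon u) f * \prod_i P i ^+ mon u i.
  by rewrite mpoly.mevalE big_tnth.
have [K [j [jE hj]]] := exists_extension [seq mpoly.mcoeff m f | m <- mpoly.msupp f] Lclosure.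
have [al alP] : exists al : 'I_r -> K, forall u, j (al u) = mpoly.mcoeff (mon u) f.
  have [|al h] := @choice _ _ (fun (u : 'I_r) y => j y = mpoly.mcoeff (mon u) f); last by exists al.
  by move=> u; apply: hj; apply: map_f; exact: mem_tnth.
pose d := \dim {:K}; pose b := @basis_in k K.
pose cd u i l : ratfun k := coord (vbasis {:K}) l (al u * b i).
have cdE u i : al u * b i = \sum_l cd u i l *: b l by exact: coord_vbasis (memvf _).
have [e e0 ePa] := common_denominator (fun x : 'I_r * 'I_d * 'I_d => cd x.1.1 x.1.2 x.2).
have [a aP] := @choice _ _ _ ePa.
pose M : 'M[{poly MP k}]_d := \matrix_(i, l) \sum_(u < r)
  (map_poly (@mpoly.mpolyC n k) (a (u, i, l)) * (mpoly.mpolyX k (mon u))%:P).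
have jZ x y : j (x *: y) = iota x * j y by rewrite -[y in LHS]mul1r scalerAl rmorphM jE.
exists (\det M); split=> [P fP|c Mc].
  pose N := map_mx (eval_out P) M; pose v : 'cV[L]_d := \col_i j (b i).
  have Nv : N *m v = 0.
    apply/matrixP => i y; rewrite !mxE.
    transitivity (iota (FracField.tofrac e) * (mpoly.meval P f * j (b i))); last first.
      by rewrite fP mul0r mulr0.
    rewrite evalf mulr_suml mulr_sumr.
    under eq_bigr => l _.
      rewrite !mxE rmorph_sum mulr_suml; over.
    rewrite exchange_big /=; apply: eq_bigr => u _.
    rewrite -alP mulrAC -rmorphM cdE rmorph_sum mulr_suml mulr_sumr; apply: eq_bigr => l _.
    by rewrite eval_out_mono -aP rmorphM jZ -!mulrA; congr (_ * (_ * _)); rewrite mulrC.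
  have /(congr1 (fun X => \adj N *m X)) := Nv.
  rewrite mulmxA mul_adj_mx mulmx0 mul_scalar_mx => /matrixP detv.
  have [i bi] : exists i, b i != 0.
    apply: contrapT => no; have : (1 : K) = 0.
      rewrite (coord_vbasis (memvf 1)) big1// => i _.
      have [bi|bi] := eqVneq (b i) 0; last by case: no; exists i.
      by rewrite [X in _ *: X]bi scaler0.
    by apply/eqP; exact: oner_neq0.
  have := detv i 0; rewrite !mxE => /eqP; rewrite mulf_eq0 fmorph_eq0 (negPf bi) orbF.
  by rewrite /N det_map_mx => /eqP.
pose N := map_mx (@FracField.tofrac {poly k}) (map_mx (eval_const c) M).
have detN : \det N = FracField.tofrac (eval_const c (\det M)) by rewrite /N !det_map_mx.
have [v v0 vN] : exists2 v : 'rV_d, v != 0 & v *m N = 0.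
  by apply/det0P; rewrite detN Mc tofrac0.
pose be := \sum_(u < r) al u * const_in K (\prod_i c i ^+ mon u i).
have jbe : j be = mpoly.meval (const_out \o c) f.
  rewrite evalf rmorph_sum; apply: eq_bigr => u _.
  rewrite rmorphM alP; congr (_ * _); rewrite jE -[LHS]/(const_out _) rmorph_prod.
  by apply: eq_bigr => i _; rewrite rmorphXn.
rewrite -jbe; suff -> : be = 0 by rewrite rmorph0.
have Nbe i : (FracField.tofrac e)%:A * (be * b i) = \sum_l N i l *: b l.
  rewrite /be mulr_suml mulr_sumr.
  under [RHS]eq_bigr => l _.
    rewrite !mxE !rmorph_sum scaler_suml; over.
  rewrite exchange_big /=; apply: eq_bigr => u _.
  rewrite mulrAC cdE mulr_suml mulr_sumr; apply: eq_bigr => l _.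
  rewrite eval_const_mono tofracM -aP.
  by rewrite /const_in /= -!scalerAl mul1r -scalerAr mulr1 !scalerA.
have sum0 : \sum_i v 0 i *: ((FracField.tofrac e)%:A * (be * b i)) = 0.
  under eq_bigr => i _.
    rewrite Nbe scaler_sumr; over.
  rewrite exchange_big /= big1// => l _.
  under eq_bigr do rewrite scalerA.
  rewrite -scaler_suml; have /matrixP/(_ 0 l) := vN; rewrite !mxE => ->.
  by rewrite scale0r.
have {}sum0 : (FracField.tofrac e)%:A * (be * \sum_i v 0 i *: b i) = 0.
  by rewrite -[RHS]sum0 !mulr_sumr; apply: eq_bigr => i _; rewrite -!scalerAr.
move: sum0 => /eqP; rewrite mulf_eq0 (fmorph_eq0 (in_alg K)) tofrac_eq0 (negPf e0) /=.
rewrite mulf_eq0 => /orP[/eqP//|/eqP vb].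
case/eqP: v0; apply/matrixP => x i; rewrite ord1 mxE.
exact: (basis_in_lin vb).
Qed.

End Norm.

(** * The lower bound for the height *)

Lemma rmorph_mmap (k K L : fieldType) (f : {rmorphism k -> K}) (g : {rmorphism k -> L})
    (j : {rmorphism K -> L}) n (x : 'I_n -> K) (P : 'I_n -> L) (q : mpoly.mpoly n k) :
  (forall c, j (f c) = g c) -> (forall i, j (x i) = P i) ->
  j (mpoly.mmap f x q) = mpoly.mmap g P q.
Proof.
move=> jf jx; rewrite /mpoly.mmap rmorph_sum; apply: eq_bigr => m _.
rewrite rmorphM jf; congr (_ * _); rewrite /mpoly.mmap1 rmorph_prod.
by apply: eq_bigr => i _; rewrite rmorphXn jx.
Qed.

Section HeightBound.
Variables (R : realType) (k : closedFieldType) (K : fieldExtType (ratfun k)).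

Lemma in_space_mmap n (x : 'I_n -> K) (g : mpoly.mpoly n k) D : (mpoly.msize g <= D)%N ->
  in_space (fun w => D * `|local_height w x|)%N (mpoly.mmap (const_in K) x g).
Proof.
move=> gD w hw; rewrite /mpoly.mmap big_seq.
apply: (big_ind (fun y => ((- (D * `|local_height w x|)%N%:Z)%:E <= w y)%E)).
- by rewrite (nval0 hw) leey.
- by move=> a b; exact: nval_addl.
move=> m mg; have mD : (mpoly.mdeg m <= D)%N.
  by rewrite (leq_trans _ gD)// ltnW// mpoly.msize_mdeg_lt.
rewrite -[(- _)%R]add0r; apply: (nval_geM hw); first exact: nval_const_ge0.
apply: (@le_trans _ _ (- (mpoly.mdeg m * `|local_height w x|)%N%:Z)%:E).
  by rewrite lee_fin lerN2 lez_nat leq_mul2r mD orbT.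
rewrite mpoly.mdegE /mpoly.mmap1.
apply: (big_rec2 (fun (y : K) e => ((- (e * `|local_height w x|)%N%:Z)%:E <= w y)%E)).
  by rewrite (nval1 hw) mul0n oppr0.
move=> i y e _ h; rewrite mulnDl PoszD opprD; apply: (nval_geM hw) => //.
have xi : ((- `|local_height w x|%N%:Z)%:E <= w (x i))%E.
  by rewrite gez0_abs ?local_height_ge0// local_height_ge.
elim: (m i) => [|l IH]; first by rewrite expr0 (nval1 hw) mul0n oppr0.
by rewrite exprS mulSn PoszD opprD; exact: nval_geM.
Qed.

(** In [degree_le_poles] take y_i = G_i(x), whose poles are at most D times those
    of x. *)
Lemma height_in_bound n (x : 'I_n -> K) (G : {poly mpoly.mpoly n k}) D :
  (forall i, (mpoly.msize G`_i <= D)%N) ->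
  (map_poly (mpoly.mmap (const_in K) x) G).[t_in K] = 0 ->
  (exists i, mpoly.mmap (const_in K) x G`_i != 0) ->
  1 <= D%:R * height_in R x.
Proof.
move=> GD G0 [i Gi].
pose y (i : 'I_(size G)) := mpoly.mmap (const_in K) x G`_i.
pose X (u : 'I_n + 'I_(\dim {:K})) := match u with inl i => x i | inr l => @basis_in k K l end.
have [s [hs sX]] := pole_support (@t_in_trans k K) (@dependent_in k K) X.
have xs w : normalized_valuation w -> w \notin s -> forall i, (0 <= w (x i))%E.
  by move=> hw ws l; exact: (sX w hw ws (inl l)).
have isz : (i < size G)%N.
  by rewrite ltnNge; apply: contra Gi => le; rewrite nth_default// mpoly.mmap0.
have := @degree_le_poles k K _ _ (@t_in_trans k K) _ (@dependent_in k K) _ (@free_in k K)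
  _ y s (fun w => D * `|local_height w x|)%N.
have -> : \sum_(j < size G) t_in K ^+ j * y j = 0.
  rewrite -[RHS]G0 (@horner_coef_wide _ (size G)) ?size_poly//.
  by apply: eq_bigr => j _; rewrite coef_map mulrC.
move=> /(_ erefl) h.
have {h}le : (\dim {:K} <= \sum_(w <- undup s) D * `|local_height w x|)%N.
  apply: h => //.
  - by exists (Ordinal isz).
  - by move=> w hw ws; rewrite local_height_eq0 ?muln0//; exact: xs.
  - by move=> w hw ws l; exact: (sX w hw ws (inr l)).
  - by move=> j; exact: in_space_mmap.
rewrite (height_inE R hs xs).
have -> : \sum_(w <- undup s) (local_height w x)%:~R =
    (\sum_(w <- undup s) `|local_height w x|)%N%:R :> R.
  rewrite natr_sum [LHS]big_seq [RHS]big_seq; apply: eq_bigr => w; rewrite mem_undup => ws.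
  by rewrite [RHS]pmulrn gez0_abs// local_height_ge0//; exact: hs.
have d0 : 0 < (\dim {:K})%:R :> R by rewrite ltr0n adim_gt0.
by rewrite mulrCA mulrC ler_pdivlMr// mul1r -natrM ler_nat big_distrr.
Qed.

End HeightBound.

Section Density.
Variables (k L : closedFieldType) (iota : {rmorphism ratfun k -> L}) (n : nat).
Local Notation phi := (mpoly.mmap (const_out iota)).
Local Notation cst c := (const_out iota \o c).

Lemma phi_cst (c : 'I_n -> k) q : phi (cst c) q = const_out iota (mpoly.meval c q).
Proof.
by apply/esym; exact: (@rmorph_mmap k k L idfun (const_out iota) (const_out iota)).
Qed.

(** If the coefficients al i are independent over k, then each q i vanishes on Z;
    a relation between them allows one term of the sum to be eliminated. *)
Lemma descend_to_constants (Z : set ('I_n -> k)) (P : 'I_n -> L) r (al : 'I_r -> L)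
    (q : 'I_r -> mpoly.mpoly n k) :
  (forall c, Z c -> \sum_i al i * phi (cst c) (q i) = 0) ->
  \sum_i al i * phi P (q i) != 0 ->
  exists2 g, forall c, Z c -> mpoly.meval c g = 0 & phi P g != 0.
Proof.
elim: r al q => [|r IH] al q Zq Pq; first by rewrite big_ord0 eqxx in Pq.
have [[a [[i ai] sum0]]|free] := pselect (exists a : 'I_r.+1 -> k,
    (exists i, a i != 0) /\ \sum_i al i * const_out iota (a i) = 0).
  pose q' l := q (lift i l) - (a (lift i l) / a i) *: q i.
  have cai : const_out iota (a i) != 0 by rewrite fmorph_eq0.
  have E Q : \sum_l al (lift i l) * phi Q (q' l) = \sum_i al i * phi Q (q i).
    rewrite (bigD1_ord i)//=.
    under eq_bigr => l _.
      rewrite /q' rmorphB /= mpoly.mmapZ mulrBr rmorphM /= fmorphV mulrA mulrA; over.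
    rewrite sumrB -!mulr_suml addrC; congr (_ + _).
    move: sum0; rewrite (bigD1_ord i)//= => /eqP; rewrite addrC addr_eq0 => /eqP ->.
    by rewrite mulNr mulfK// mulNr opprK.
  apply: (IH (fun l => al (lift i l)) q'); last by rewrite E.
  by move=> c Zc; rewrite E; exact: Zq.
have [i Pi] : exists i, phi P (q i) != 0.
  apply: contrapT => no; move/eqP: Pq; apply; apply: big1 => i _.
  have [->|Pi] := eqVneq (phi P (q i)) 0; first by rewrite mulr0.
  by case: no; exists i.
exists (q i) => // c Zc; apply: contrapT => ci; apply: free.
exists (fun i => mpoly.meval c (q i)); split; first by exists i; apply/eqP.
by rewrite -[RHS](Zq c Zc); apply: eq_bigr => l _; rewrite phi_cst.
Qed.

End Density.

Theorem theorem1p3 (R : realType) (k L : closedFieldType)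
    (iota : {rmorphism ratfun k -> L}) (Lclosure : is_algebraic_closure iota)
    (n : nat) (n_ge1 : (1 <= n)%N)
    (V : set ('I_n -> L)) (Vclosed : zariski_closed V) :
  exists2 eps : R, 0 < eps &
    forall P : 'I_n -> L,
      (V `\` zariski_closure (V `&` constant_points iota (n := n))) P ->
      eps <= height iota R P.
Proof.
have [S VS] := Vclosed.
have [s [sS sP]] := finite_equations S.
have [G GP] := @choice _ _ _ (norm_polynomial Lclosure (n := n)).
(* D bounds the degrees of all the coefficients of the norms; the successor
   makes it positive *)
pose D := (\max_(f <- s) \max_(i < size (G f)) mpoly.msize (G f)`_i).+1.
exists D%:R^-1; first by rewrite invr_gt0 ltr0n.
move=> P [VP nWP].
have [r [K [j [x [jE jx rE]]]]] : exists r, exists (K : fieldExtType (ratfun k))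
    (j : {rmorphism K -> L}) (x : 'I_n -> K),
    [/\ forall a : ratfun k, j a%:A = iota a, forall i, j (x i) = P i & r = height_in R x].
  have [K [j [jE hj]]] := exists_extension (codom P) Lclosure.
  have [|x xP] := @choice _ _ (fun i y => j y = P i).
    by move=> i; apply: hj; exact: codom_f.
  by exists (height_in R x), K, j, x.
(* whichever K the definition of the height picks, the bound holds in it *)
have {r K j x jE jx rE} : exists (K : fieldExtType (ratfun k)) (j : {rmorphism K -> L})
    (x : 'I_n -> K),
    [/\ forall a : ratfun k, j a%:A = iota a, forall i, j (x i) = P i
      & height iota R P = height_in R x].
  pose hts := [set r | exists (K : fieldExtType (ratfun k)) (j : {rmorphism K -> L})
    (x : 'I_n -> K), [/\ forall a : ratfun k, j a%:A = iota a,
      forall i, j (x i) = P i & r = height_in R x]].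
  have ex : exists r, hts r by exists r, K, j, x.
  by have := xgetPex 0 ex.
move=> [K [j [x [jE jx ->]]]].
have jmap q : j (mpoly.mmap (const_in K) x q) = mpoly.mmap (const_out iota) P q.
  by apply: rmorph_mmap => // c; exact: jE.
rewrite -[leLHS]mul1r ler_pdivrMr ?ltr0n// mulrC.
(* otherwise every polynomial over k that vanishes on the constant points of V
   vanishes at P, and P lies in their closure *)
have [f [fs [i Gi]]] : exists f, f \in s /\ exists i, mpoly.mmap (const_in K) x (G f)`_i != 0.
  apply: contrapT => no; apply: nWP => Z [[T ZT] VZ].
  rewrite ZT /= => p Tp; apply/eqP/negPn/negP => pP.
  pose Zk := [set c : 'I_n -> k | V (const_out iota \o c)].
  pose m (u : 'I_(size (mpoly.msupp p))) := tnth (in_tuple (mpoly.msupp p)) u.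
  have pE Q : mpoly.meval Q p =
      \sum_u mpoly.mcoeff (m u) p * mpoly.mmap (const_out iota) Q (mpoly.mpolyX k (m u)).
    rewrite mpoly.mevalE big_tnth; apply: eq_bigr => u _; by rewrite mpoly.mmapX.
  have [c Zc||g gZ gP] := @descend_to_constants k L iota n Zk P _
    (fun u => mpoly.mcoeff (m u) p) (fun u => mpoly.mpolyX k (m u)).
  - rewrite -pE; have : Z (const_out iota \o c).
      by apply: VZ; split=> // l; exists (c l).
    by rewrite ZT; exact.
  - by rewrite -pE.
  have gx : mpoly.mmap (const_in K) x g != 0 by rewrite -(fmorph_eq0 j) jmap.
  have [c gc cP] := specialization (@t_in_trans k K) (@dependent_in k K) gx.
  move/eqP: gc; apply; apply: gZ; rewrite /Zk /= VS => q; apply: sP q => q qs.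
  have [_] := GP q; apply; apply/polyP => l; rewrite coef_map coef0; apply: cP.
  by apply/eqP/negPn/negP => nz; apply: no; exists q; split=> //; exists l.
apply: (@height_in_bound R k K n x (G f)); last by exists i.
- move=> l; have [lt|le] := ltnP l (size (G f)); last by rewrite nth_default// mpoly.msize0.
  rewrite /D leqW// (leq_trans _ (leq_bigmax_seq _ fs isT))//.
  exact: (@leq_bigmax _ (fun i : 'I_(size (G f)) => mpoly.msize (G f)`_i) (Ordinal lt)).
- have [+ _] := GP f => /(_ P) h.
  apply/eqP; rewrite -(fmorph_eq0 j); apply/eqP.
  have -> : j (map_poly (mpoly.mmap (const_in K) x) (G f)).[t_in K] =
      (map_poly (mpoly.mmap (const_out iota) P) (G f)).[t_out iota].
    rewrite -horner_map /= jE; congr (_.[_]).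
    by apply/polyP => l; rewrite !coef_map /= ; exact: jmap.
  by apply: h; move: VP; rewrite VS; apply; exact: sS.
Qed.
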